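(* Let $A$ be a ring such that the inclusion functor $e_* : \mathsf{E}(A) \to \mathsf{K}(\mathsf{Pro}\,A)$ has a right adjoint $e^! : \mathsf{K}(\mathsf{Pro}\,A) \to \mathsf{E}(A)$. Let $M$ and $N$ be left $A$-modules. Then there is a long exact sequence $$0 \to \operatorname{Ext}^1_{\mathcal{G}}(M,N) \to \operatorname{Ext}^1(M,N) \to \widehat{\operatorname{Ext}}^1(M,N) \to \cdots \to \operatorname{Ext}^i_{\mathcal{G}}(M,N) \to \operatorname{Ext}^i(M,N) \to \widehat{\operatorname{Ext}}^i(M,N) \to \operatorname{Ext}^{i+1}_{\mathcal{G}}(M,N) \to \cdots ,$$ natural in $M$ and $N$.
   Context: Complexes are written cohomologically: $\cdots \to X^{i-1} \to X^i \to X^{i+1} \to \cdots$, and may be unbounded. For a complex $X$ and a module $N$, $\operatorname{Hom}_A(X,N)$ is the complex with $\operatorname{Hom}_A(X^{-i},N)$ in cohomological degree $i$. $\mathsf{K}(\mathsf{Pro}\,A)$ is the homotopy category of complexes of projective left $A$-modules (morphisms are homotopy classes of chain maps). $\mathsf{E}(A)$ is the class of complexes $E$ of left $A$-modules such that $E$ consists of projective modules, $E$ is exact, and $\operatorname{Hom}_A(E,Q)$ is exact for each projective left $A$-module $Q$. It is viewed as a full subcategory of $\mathsf{K}(\mathsf{Pro}\,A)$, with inclusion functor $e_*$. A projective resolution of $M$ is a complex of projectives concentrated in non-positive cohomological degrees, and $\operatorname{res} : \mathsf{Mod}(A) \to \mathsf{K}(\mathsf{Pro}\,A)$ is a functor sending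 each left $A$-module to a projective resolution of it, giving an equivalence of $\mathsf{Mod}(A)$ with the full subcategory of projective resolutions. Tate Ext groups: $\widehat{\operatorname{Ext}}^i(M,N) = \operatorname{H}^i \operatorname{Hom}_A(e^! \operatorname{res} M, N)$. $\operatorname{Ext}^i(M,N) = \operatorname{H}^i\operatorname{Hom}_A(\operatorname{res} M,N)$ is the ordinary Ext group over $A$. A left $A$-module is Gorenstein projective if it has the form $\operatorname{Ker}(E^1 \to E^2)$ for some $E$ in $\mathsf{E}(A)$. A homomorphism $X \xrightarrow{s} Y$ is a relative epimorphism with respect to the class of Gorenstein projective modules if each homomorphism $G \to Y$ with $G$ Gorenstein projective factors through $s$. An augmented Gorenstein projective resolution of $M$ is an exact sequence $\cdots \to G^{-1} \to G^0 \to M \to 0$ in which each $G^{j}$ is Gorenstein projective and such that, when the sequence is split up into short exact sequences, the surjection in each of these is a relative epimorphism with respect to the class of Gorenstein projective modules; the complex $G = \cdots \to G^{-1} \to G^0 \to 0 \to \cdots$ is then called a Gorenstein projective resolution of $M$ (some authors say ''proper''). Under the assumption on $A$ in the claim, every left $A$-module has such a resolution. Relative Ext groups: $\operatorname{Ext}^i_{\mathcal{G}}(M,N) = \operatorname{H}^i\operatorname{Hom}_A(G,N)$, where $G$ is a Gorenstein projective resolution of $M$. *)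

(* Defs.v *)
From HB Require Import structures.
From mathcomp Require Import all_boot all_order all_algebra.
From mathcomp Require Import boolp.

Set Implicit Arguments.
Unset Strict Implicit.
Unset Printing Implicit Defensive.

Import Order.TTheory GRing.Theory Num.Theory.
Local Open Scope ring_scope.

(* Categories whose hom-sets are presented as setoids: [heq] plays the role   *)
(* of equality of morphisms, so a homotopy category has chain maps as         *)
(* representatives of its morphisms and homotopy as [heq].                    *)

Record category := Category {
  ob :> Type;
  hom : ob -> ob -> Type;
  heq : forall X Y : ob, hom X Y -> hom X Y -> Prop;
  idm : forall X : ob, hom X X;
  cmp : forall X Y Z : ob, hom Y Z -> hom X Y -> hom X Z;
  heq_refl : forall X Y (f : hom X Y), heq f f;
  heq_sym : forall X Y (f g : hom X Y), heq f g -> heq g f;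
  heq_trans : forall X Y (f g h : hom X Y), heq f g -> heq g h -> heq f h;
  cmp_heq : forall X Y Z (g g' : hom Y Z) (f f' : hom X Y),
    heq g g' -> heq f f' -> heq (cmp g f) (cmp g' f');
  cmp_idl : forall X Y (f : hom X Y), heq (cmp (idm Y) f) f;
  cmp_idr : forall X Y (f : hom X Y), heq (cmp f (idm X)) f;
  cmpA : forall X Y Z W (h : hom Z W) (g : hom Y Z) (f : hom X Y),
    heq (cmp h (cmp g f)) (cmp (cmp h g) f) }.

Arguments heq {c X Y} f g.
Arguments idm {c} X.
Arguments cmp {c X Y Z} g f.
Notation "f =h g" := (heq f g) (at level 70).

Record functor (C D : category) := Functor {
  fob :> C -> D;
  fmap : forall X Y : C, hom X Y -> hom (fob X) (fob Y);
  fmap_heq : forall X Y (f g : hom X Y), f =h g -> fmap f =h fmap g;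
  fmap_id : forall X : C, fmap (idm X) =h idm (fob X);
  fmap_cmp : forall X Y Z (g : hom Y Z) (f : hom X Y),
    fmap (cmp g f) =h cmp (fmap g) (fmap f) }.

Arguments fmap {C D} f {X Y} _ : rename.

(* [adjunction L R]: R is right adjoint to L. *)
Record adjunction (C D : category) (L : functor C D) (R : functor D C) :=
  Adjunction {
  adj : forall (X : C) (Y : D), hom (L X) Y -> hom X (R Y);
  adjV : forall (X : C) (Y : D), hom X (R Y) -> hom (L X) Y;
  adj_heq : forall X Y (f g : hom (L X) Y), f =h g -> adj f =h adj g;
  adjV_heq : forall X Y (f g : hom X (R Y)), f =h g -> adjV f =h adjV g;
  adjK : forall X Y (f : hom (L X) Y), adjV (adj f) =h f;
  adjVK : forall X Y (f : hom X (R Y)), adj (adjV f) =h f;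
  adj_natl : forall X X' Y (f : hom (L X) Y) (a : hom X' X),
    adj (cmp f (fmap L a)) =h cmp (adj f) a;
  adj_natr : forall X Y Y' (f : hom (L X) Y) (b : hom Y Y'),
    adj (cmp b f) =h cmp (fmap R b) (adj f) }.

Section FullSubcategory.
Variables (C : category) (P : C -> Prop).

Definition full_sub : category :=
  @Category {X : C | P X} (fun X Y => hom (sval X) (sval Y))
    (fun X Y => @heq C _ _) (fun X => idm (sval X)) (fun X Y Z => @cmp C _ _ _)
    (fun X Y => @heq_refl C _ _) (fun X Y => @heq_sym C _ _)
    (fun X Y => @heq_trans C _ _) (fun X Y Z => @cmp_heq C _ _ _)
    (fun X Y => @cmp_idl C _ _) (fun X Y => @cmp_idr C _ _)
    (fun X Y Z W => @cmpA C _ _ _ _).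

Definition incl : functor full_sub C :=
  @Functor full_sub C (fun X => sval X) (fun X Y f => f)
    (fun X Y f g fg => fg) (fun X => @heq_refl C _ _ _)
    (fun X Y Z g f => @heq_refl C _ _ _).

End FullSubcategory.


Section LinearHom.
Variables (A : pzRingType) (U V : lmodType A).
Implicit Types f g h : {linear U -> V}.

Lemma linear_ext f g : f =1 g -> f = g.
Proof.
case: f g => [f [[[f1 f2]] [f3]]] [g [[[g1 g2]] [g3]]] /= /funext fg.
subst g; congr GRing.Linear.Pack; congr GRing.Linear.Class.
  by rewrite (Prop_irrelevance f1 g1) (Prop_irrelevance f2 g2).
by rewrite (Prop_irrelevance f3 g3).
Qed.

HB.instance Definition _ := gen_eqMixin {linear U -> V}.
HB.instance Definition _ := gen_choiceMixin {linear U -> V}.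

Definition linear_zero : {linear U -> V} := \0.
Definition linear_add f g : {linear U -> V} := f \+ g.
Definition linear_opp f : {linear U -> V} := \- f.

Fact linear_addA : associative linear_add.
Proof. by move=> f g h; apply: linear_ext => x; apply: addrA. Qed.
Fact linear_addC : commutative linear_add.
Proof. by move=> f g; apply: linear_ext => x; apply: addrC. Qed.
Fact linear_add0 : left_id linear_zero linear_add.
Proof. by move=> f; apply: linear_ext => x; apply: add0r. Qed.
Fact linear_addN : left_inverse linear_zero linear_opp linear_add.
Proof. by move=> f; apply: linear_ext => x; apply: addNr. Qed.

HB.instance Definition _ := GRing.isZmodule.Build {linear U -> V}
  linear_addA linear_addC linear_add0 linear_addN.

End LinearHom.

Section ModuleCategory.
Variable A : pzRingType.

Definition Mod : category.
Proof.
refine (@Category (lmodType A) (fun U V => {linear U -> V})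
  (fun U V f g => f =1 g) (fun U => idfun : {linear U -> U})
  (fun U V W g f => (g \o f : {linear U -> W})) _ _ _ _ _ _ _) => //.
- by move=> U V f g fg x; rewrite fg.
- by move=> U V f g h fg gh x; rewrite fg gh.
- by move=> U V W g g' f f' gg' ff' x /=; rewrite ff' gg'.
Defined.

Definition surjective (U V : Type) (f : U -> V) := forall y, exists x, f x = y.

Definition projective (P : lmodType A) : Prop :=
  forall (U V : lmodType A) (s : {linear U -> V}) (f : {linear P -> V}),
    surjective s -> exists g : {linear P -> U}, s \o g =1 f.

End ModuleCategory.

Section KernelModule.
Variables (A : pzRingType) (U V : lmodType A) (f : {linear U -> V}).

Definition ker_pred : {pred U} := fun x => f x == 0.

Fact ker_pred_closed : submod_closed ker_pred.
Proof.
split=> [|a x y]; rewrite !unfold_in ?linear0 // => /eqP fx /eqP fy.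
by rewrite linearP fx fy scaler0 addr0.
Qed.
HB.instance Definition _ := GRing.isSubmodClosed.Build A U ker_pred
  ker_pred_closed.

Record kermod : predArgType := Kermod { kerval : U; _ : kerval \in ker_pred }.

HB.instance Definition _ := [isSub of kermod for kerval].
HB.instance Definition _ := [Choice of kermod by <:].
HB.instance Definition _ := [SubChoice_isSubLmodule of kermod by <:].

Variables (W : lmodType A) (g : {linear W -> U}).
Hypothesis fg0 : forall x, f (g x) = 0.

Fact corestr_subproof x : g x \in ker_pred.
Proof. by rewrite unfold_in fg0. Qed.

Definition corestr_fun (x : W) : kermod := Kermod (corestr_subproof x).

Fact corestr_is_linear : linear corestr_fun.
Proof. by move=> a x y; apply: val_inj; rewrite /= linearP. Qed.
HB.instance Definition _ := GRing.isLinear.Build A W kermod _ corestr_fun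
  corestr_is_linear.

Definition corestr : {linear W -> kermod} := corestr_fun.

End KernelModule.

(* Complexes, indexed cohomologically by all integers. The differential       *)
(* X^i -> X^(i+1) takes the target degree j with a proof of i + 1 = j, to     *)
(* avoid transporting along equalities such as - (i + 1) + 1 = - i.           *)

Record zcomplex := ZComplex {
  zob :> int -> zmodType;
  zd : forall i j : int, i + 1 = j -> {additive zob i -> zob j};
  zdd : forall (i j k : int) (h : i + 1 = j) (h' : j + 1 = k) (x : zob i),
    zd h' (zd h x) = 0 }.

Arguments zd {C i j} h : rename.

Definition zexact_at (C : zcomplex) (j : int) : Prop :=
  forall (i k : int) (h : i + 1 = j) (h' : j + 1 = k) (y : C j),
    zd h' y = 0 -> exists x : C i, zd h x = y.

Definition zexact (C : zcomplex) : Prop := forall i, zexact_at C i.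

Record zmap (C D : zcomplex) := ZMap {
  zmap_at :> forall i : int, {additive C i -> D i};
  zmapd : forall (i j : int) (h : i + 1 = j) (x : C i),
    zmap_at j (zd h x) = zd h (zmap_at i x) }.

Section Cohomology.
Variables (C : zcomplex) (i : int).

Definition cocycle_pred : {pred C i} := fun x => zd (erefl (i + 1)) x == 0.

Fact cocycle_closed : zmod_closed cocycle_pred.
Proof.
split=> [|x y]; rewrite !unfold_in ?raddf0 // => /eqP fx /eqP fy.
by rewrite raddfB fx fy subr0.
Qed.
HB.instance Definition _ := GRing.isZmodClosed.Build (C i) cocycle_pred
  cocycle_closed.

Record cocycle : predArgType :=
  Cocycle { cocycle_val : C i; _ : cocycle_val \in cocycle_pred }.

HB.instance Definition _ := [isSub of cocycle for cocycle_val].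
HB.instance Definition _ := [Choice of cocycle by <:].
HB.instance Definition _ := [SubChoice_isSubZmodule of cocycle by <:].

Definition coboundary_pred : {pred cocycle} :=
  fun z => `[< exists y : C (i - 1), zd (subrK 1 i) y = val z >].

Fact coboundary_closed : zmod_closed coboundary_pred.
Proof.
split=> [|x y].
  by apply/asboolP; exists 0; rewrite !raddf0.
move=> /asboolP[u ux] /asboolP[v vy]; apply/asboolP.
by exists (u - v); rewrite raddfB ux vy raddfB.
Qed.
HB.instance Definition _ := GRing.isZmodClosed.Build cocycle coboundary_pred
  coboundary_closed.

Definition cohomology : zmodType := {ideal_quot coboundary_pred}.

Definition coclass (z : cocycle) : cohomology := \pi_({ideal_quot coboundary_pred})%qT z.

End Cohomology.

Section CohomologyMap.
Variables (C D : zcomplex) (f : zmap C D) (i : int).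

Fact cocycle_map_subproof (z : cocycle C i) : f i (val z) \in @cocycle_pred D i.
Proof.
case: z => x /= zx; have /eqP dx : zd (erefl (i + 1)) x == 0 := zx.
by rewrite unfold_in -zmapd dx raddf0.
Qed.

Definition cocycle_map (z : cocycle C i) : cocycle D i :=
  Cocycle (cocycle_map_subproof z).

Definition coh_map_fun (c : cohomology C i) : cohomology D i :=
  coclass (cocycle_map (repr c)).

Lemma coh_map_coclass (z : cocycle C i) :
  coh_map_fun (coclass z) = coclass (cocycle_map z).
Proof.
apply/eqP; rewrite -Quotient.idealrBE; apply/asboolP.
have: (repr (coclass z) == z %[mod {ideal_quot (@coboundary_pred C i)}])%qT.
  by rewrite reprK.
rewrite -Quotient.idealrBE => /asboolP[y dy].
by exists (f (i - 1) y); rewrite -zmapd dy !raddfB.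
Qed.

Fact coh_map_is_additive : zmod_morphism coh_map_fun.
Proof.
elim/quotW => x; elim/quotW => y.
have <- : coclass (x - y) = (\pi x - \pi y)%qT by apply: raddfB.
rewrite !coh_map_coclass -[RHS](raddfB (\pi_({ideal_quot _}))%qT).
by congr coclass; apply: val_inj; rewrite /= raddfB.
Qed.
HB.instance Definition _ := GRing.isZmodMorphism.Build _ _ coh_map_fun
  coh_map_is_additive.

Definition coh_map : {additive cohomology C i -> cohomology D i} := coh_map_fun.

End CohomologyMap.

Section ModuleComplexes.
Variable A : pzRingType.

Record complex := Complex {
  cob :> int -> lmodType A;
  cd : forall i j : int, i + 1 = j -> {linear cob i -> cob j};
  cdd : forall (i j k : int) (h : i + 1 = j) (h' : j + 1 = k) (x : cob i),
    cd h' (cd h x) = 0 }.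

Arguments cd X {i j} h : rename.

Definition zcomplex_of (X : complex) : zcomplex :=
  @ZComplex (fun i => X i : zmodType)
    (fun i j h => cd X h : {additive X i -> X j}) (@cdd X).

Definition exact_at (X : complex) (i : int) : Prop := zexact_at (zcomplex_of X) i.

Record chmap (X Y : complex) := ChMap {
  chmap_at :> forall i : int, {linear X i -> Y i};
  chmapd : forall (i j : int) (h : i + 1 = j) (x : X i),
    chmap_at j (cd X h x) = cd Y h (chmap_at i x) }.

Definition homotopic (X Y : complex) (f g : chmap X Y) : Prop :=
  exists s : forall i j : int, i + 1 = j -> {linear X j -> Y i},
    forall (i j k : int) (h : i + 1 = j) (h' : j + 1 = k) (x : X j),
      f j x - g j x = cd Y h (s i j h x) + s j k h' (cd X h' x).

Definition chmap_id (X : complex) : chmap X X :=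
  @ChMap X X (fun i => idfun : {linear X i -> X i}) (fun i j h x => erefl).

Fact chmap_comp_subproof (X Y Z : complex) (g : chmap Y Z) (f : chmap X Y)
    (i j : int) (h : i + 1 = j) (x : X i) :
  (g j \o f j) (cd X h x) = cd Z h ((g i \o f i) x).
Proof. by rewrite /= !chmapd. Qed.

Definition chmap_comp (X Y Z : complex) (g : chmap Y Z) (f : chmap X Y) :
    chmap X Z :=
  @ChMap X Z (fun i => g i \o f i : {linear X i -> Z i})
    (chmap_comp_subproof g f).

Lemma homotopic_refl X Y (f : chmap X Y) : homotopic f f.
Proof. by exists (fun i j _ => 0) => i j k h h' x; rewrite subrr linear0 addr0. Qed.

Lemma homotopic_sym X Y (f g : chmap X Y) : homotopic f g -> homotopic g f.
Proof.
case=> s fg; exists (fun i j h => - s i j h) => i j k h h' x.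
by rewrite -opprB (fg _ _ _ h h') opprD linearN.
Qed.

Lemma homotopic_trans X Y (f g e : chmap X Y) :
  homotopic f g -> homotopic g e -> homotopic f e.
Proof.
case=> s fg [t ge]; exists (fun i j h => s i j h + t i j h) => i j k h h' x.
by rewrite -(subrKA (g j x)) (fg _ _ _ h h') (ge _ _ _ h h') linearD addrACA.
Qed.

Lemma homotopic_comp X Y Z (g g' : chmap Y Z) (f f' : chmap X Y) :
  homotopic g g' -> homotopic f f' ->
  homotopic (chmap_comp g f) (chmap_comp g' f').
Proof.
case=> s gg' [t ff'].
exists (fun i j h => linear_add (s i j h \o f j) (g' i \o t i j h)) => i j k h h' x /=.
rewrite -(subrKA (g' j (f j x))) (gg' _ _ _ h h') -linearB (ff' _ _ _ h h').
by rewrite !linearD /= !chmapd addrACA.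
Qed.

(* The homotopy category K(Mod A), and K(Pro A) inside it. *)
Definition KMod : category.
Proof.
refine (@Category complex chmap homotopic chmap_id chmap_comp homotopic_refl
  homotopic_sym homotopic_trans homotopic_comp _ _ _) => *.
- by exists (fun i j _ => 0) => i j k h h' x; rewrite subrr linear0 addr0.
- by exists (fun i j _ => 0) => i j k h h' x; rewrite subrr linear0 addr0.
- by exists (fun i j _ => 0) => i j k h h' x; rewrite subrr linear0 addr0.
Defined.

Definition KPro : category :=
  full_sub (fun X : KMod => forall i : int, projective (cob X i)).

End ModuleComplexes.

Arguments cd {A} X {i j} h : rename.

(* Hom_A(X, N): degree i is Hom_A(X^(-i), N). *)
Section HomComplex.
Variable A : pzRingType.

Fact homc_degree (i j : int) : i + 1 = j -> - j + 1 = - i.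
Proof. by move=> <-; rewrite opprD addrNK. Qed.

Section HomComplexDef.
Variables (X : complex A) (N : lmodType A).

Definition homc_d_fun i j (h : i + 1 = j) (u : {linear X (- i) -> N}) :
  {linear X (- j) -> N} := u \o cd X (homc_degree h).

Fact homc_d_is_additive i j (h : i + 1 = j) : zmod_morphism (homc_d_fun h).
Proof. by move=> u v; apply: linear_ext. Qed.
HB.instance Definition _ i j (h : i + 1 = j) :=
  GRing.isZmodMorphism.Build _ _ (homc_d_fun h) (homc_d_is_additive h).

Fact homc_dd (i j k : int) (h : i + 1 = j) (h' : j + 1 = k)
  (u : {linear X (- i) -> N}) : homc_d_fun h' (homc_d_fun h u) = 0.
Proof. by apply: linear_ext => x; rewrite /= cdd linear0. Qed.

Definition homc : zcomplex :=
  @ZComplex (fun i => {linear X (- i) -> N} : zmodType)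
    (fun i j h => homc_d_fun h : {additive _ -> _}) homc_dd.

End HomComplexDef.

Section Precomposition.
Variables (X Y : complex A) (f : chmap X Y) (N : lmodType A).

Definition homc_pre_fun i (u : {linear Y (- i) -> N}) : {linear X (- i) -> N} :=
  u \o f (- i).

Fact homc_pre_is_additive i : zmod_morphism (@homc_pre_fun i).
Proof. by move=> u v; apply: linear_ext. Qed.
HB.instance Definition _ i :=
  GRing.isZmodMorphism.Build _ _ (@homc_pre_fun i) (@homc_pre_is_additive i).

Fact homc_pre_d i j (h : i + 1 = j) (u : homc Y N i) :
  homc_pre_fun (zd h u) = zd (C := homc X N) h (homc_pre_fun u).
Proof. by apply: linear_ext => x; rewrite /= chmapd. Qed.

Definition homc_pre : zmap (homc Y N) (homc X N) :=
  @ZMap (homc Y N) (homc X N)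
    (fun i => @homc_pre_fun i : {additive homc Y N i -> homc X N i}) homc_pre_d.

End Precomposition.

Section Postcomposition.
Variables (X : complex A) (N N' : lmodType A) (g : {linear N -> N'}).

Definition homc_post_fun i (u : {linear X (- i) -> N}) :
  {linear X (- i) -> N'} := g \o u.

Fact homc_post_is_additive i : zmod_morphism (@homc_post_fun i).
Proof. by move=> u v; apply: linear_ext => x; rewrite /= linearB. Qed.
HB.instance Definition _ i :=
  GRing.isZmodMorphism.Build _ _ (@homc_post_fun i) (@homc_post_is_additive i).

Fact homc_post_d i j (h : i + 1 = j) (u : homc X N i) :
  homc_post_fun (zd h u) = zd (C := homc X N') h (homc_post_fun u).
Proof. exact: linear_ext. Qed.

Definition homc_post : zmap (homc X N) (homc X N') :=
  @ZMap (homc X N) (homc X N')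
    (fun i => @homc_post_fun i : {additive homc X N i -> homc X N' i})
    homc_post_d.

End Postcomposition.

End HomComplex.

Section Gorenstein.
Variable A : pzRingType.

Definition totally_acyclic (E : complex A) : Prop :=
  [/\ forall i, projective (E i),
      forall i, exact_at E i
    & forall Q : lmodType A, projective Q -> zexact (homc E Q)].

Definition E_cat : category :=
  full_sub (fun X : KPro A => totally_acyclic (sval X)).

Definition E_incl : functor E_cat (KPro A) :=
  incl (fun X : KPro A => totally_acyclic (sval X)).

Definition gorenstein_projective (M : lmodType A) : Prop :=
  exists2 E : complex A, totally_acyclic E &
    exists f : {linear M -> kermod (cd E (erefl 2 : 1 + 1 = 2))}, bijective f.

Definition gp_relative_epi (X Y : lmodType A) (s : {linear X -> Y}) : Prop :=
  forall (G : lmodType A) (f : {linear G -> Y}), gorenstein_projective G ->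
    exists g : {linear G -> X}, s \o g =1 f.

Record augmentation (X : complex A) (M : lmodType A) := Augmentation {
  aug :> {linear X 0 -> M};
  aug_d : forall (i : int) (h : i + 1 = 0) (x : X i), aug (cd X h x) = 0 }.

(* ... -> X^(-1) -> X^0 -> M -> 0 is exact, and X^i = 0 for i > 0. *)
Definition resolution (X : complex A) (M : lmodType A)
    (e : augmentation X M) : Prop :=
  [/\ forall i : int, 0 < i -> forall x : X i, x = 0,
      surjective e,
      forall (i : int) (h : i + 1 = 0) (y : X 0), e y = 0 ->
        exists x : X i, cd X h x = y
    & forall i : int, i < 0 -> exact_at X i].

Record gp_resolution (M : lmodType A) := GPResolution {
  gpr :> complex A;
  gpr_aug : augmentation gpr M;
  gpr_resolution : resolution gpr_aug;
  gpr_gp : forall i : int, i <= 0 -> gorenstein_projective (gpr i);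
  gpr_proper_aug : gp_relative_epi gpr_aug;
  gpr_proper0 : forall (i : int) (h : i + 1 = 0),
    gp_relative_epi (corestr (fun x => aug_d gpr_aug h x));
  gpr_proper : forall (i j k : int) (h : i + 1 = j) (h' : j + 1 = k), k <= 0 ->
    gp_relative_epi (corestr (fun x => @cdd A gpr i j k h h' x)) }.

(* A chain map between resolutions covering a homomorphism of modules. *)
Definition lifts (X X' : complex A) (M M' : lmodType A) (e : augmentation X M)
    (e' : augmentation X' M') (f : {linear M -> M'}) (phi : chmap X X') : Prop :=
  forall x : X 0, e' (phi 0 x) = f (e x).

(* Such a chain map exists for every f, so that quantifying over the chain    *)
(* maps lifting f, as is done below for the action of f on Ext_G, is never    *)
(* vacuous.                                                                   *)
Section GPLift.
Variables (M M' : lmodType A) (f : {linear M' -> M}).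
Variables (G : gp_resolution M) (G' : gp_resolution M').

Let deg (n : nat) : int := if n is n'.+1 then Negz n' else 0.

Let degS n : deg n.+1 + 1 = deg n.
Proof. by case: n => [|n] //=; rewrite !NegzE -[n.+2]addn1 PoszD opprD addrNK. Qed.

Let deg_le0 n : deg n <= 0.
Proof. by case: n. Qed.

Let pairing n : Type :=
  ({linear G' (deg n) -> G (deg n)} * {linear G' (deg n.+1) -> G (deg n.+1)})%type.

Let square n (u : pairing n) : Prop :=
  forall x, cd G (degS n) (u.2 x) = u.1 (cd G' (degS n) x).

Let start : exists u : pairing 0,
  (forall x, gpr_aug G (u.1 x) = f (gpr_aug G' x)) /\ square u.
Proof.
have [p Ep] := @gpr_proper_aug M G _ (f \o gpr_aug G')
  (gpr_gp G' (lexx 0)).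
pose h := degS 0; pose v : {linear G' (deg 1) -> G 0} := p \o cd G' h.
have v0 x : gpr_aug G (v x) = 0.
  by rewrite [LHS](Ep (cd G' h x)) /= aug_d linear0.
have [q Eq] := @gpr_proper0 M G _ h _ (corestr v0) (gpr_gp G' (deg_le0 1)).
exists (p, q); split=> // x.
exact: (congr1 (fun z => kerval z) (Eq x)).
Qed.

Let step n (u : pairing n) : square u ->
  exists r, square ((u.2, r) : pairing n.+1).
Proof.
move=> su; pose v : {linear G' (deg n.+2) -> G (deg n.+1)} :=
  u.2 \o cd G' (degS n.+1).
have v0 x : cd G (degS n) (v x) = 0 by rewrite su cdd linear0.
have [q Eq] := @gpr_proper M G _ _ _ (degS n.+1) (degS n) (deg_le0 n) _ (corestr v0)
  (gpr_gp G' (deg_le0 n.+2)).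
exists q => x; exact: (congr1 (fun z => kerval z) (Eq x)).
Qed.

Let tower (n : nat) : {u : pairing n | square u} :=
  nat_rect (fun n => {u : pairing n | square u})
    (exist _ _ (svalP (cid start)).2)
    (fun n u => exist _ (_, _) (svalP (cid (step (svalP u))))) n.

Lemma gp_lift_exists :
  exists phi : chmap G' G, lifts (gpr_aug G') (gpr_aug G) f phi.
Proof.
pose phi (i : int) : {linear G' i -> G i} :=
  match i with
  | Posz 0 => (sval (tower 0)).1
  | Posz n.+1 => 0
  | Negz n => (sval (tower n)).2
  end.
have phid (i j : int) (h : i + 1 = j) (x : G' i) :
    phi j (cd G' h x) = cd G h (phi i x).
  case: i h x => [n|n] h x.
    case: (gpr_resolution G) => G0 _ _ _.
    have j0 : 0 < j by rewrite -h -PoszD addn1.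
    by rewrite [LHS]G0 // [RHS]G0.
  have ej : j = deg n by rewrite -h; apply: (degS n).
  move: h; rewrite ej => h; rewrite (eq_irrelevance h (degS n)).
  have -> : phi (deg n) = (sval (tower n)).1 by case: (n).
  by rewrite (svalP (tower n)).
exists (ChMap phid) => x; exact: (svalP (cid start)).1.
Qed.

End GPLift.

(* The functor res; that it is an equivalence onto the full subcategory of    *)
(* projective resolutions follows from the comparison theorem.                *)
Record resolution_functor := ResolutionFunctor {
  res :> functor (Mod A) (KPro A);
  res_aug : forall M : lmodType A, augmentation (sval (res M)) M;
  res_resolution : forall M : lmodType A, resolution (res_aug M);
  res_lifts : forall (M M' : lmodType A) (f : {linear M -> M'}),
    lifts (res_aug M) (res_aug M') f (fmap res (f : @hom (Mod A) M M')) }.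

End Gorenstein.

Section Ext.
Variable A : pzRingType.
Implicit Types (M N : lmodType A) (i : int).

Definition Hhom (X : complex A) N i : zmodType := cohomology (homc X N) i.

Definition Hhom_pre (X Y : complex A) (f : chmap X Y) N i :
  {additive Hhom Y N i -> Hhom X N i} := coh_map (homc_pre f N) i.

Definition Hhom_post (X : complex A) N N' (g : {linear N -> N'}) i :
  {additive Hhom X N i -> Hhom X N' i} := coh_map (homc_post X g) i.

Definition Ext (R : resolution_functor A) M N i : zmodType :=
  Hhom (sval (res R M)) N i.

Definition Ext_pre (R : resolution_functor A) M M' (f : {linear M' -> M}) N i :
    {additive Ext R M N i -> Ext R M' N i} :=
  Hhom_pre (fmap (res R) (f : @hom (Mod A) M' M)) N i.

Definition Ext_post (R : resolution_functor A) M N N' (g : {linear N -> N'}) i :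
    {additive Ext R M N i -> Ext R M N' i} :=
  Hhom_post (sval (res R M)) g i.

Section Tate.
Variables (e : functor (KPro A) (E_cat A)) (R : resolution_functor A).

Definition TateExt M N i : zmodType := Hhom (sval (sval (e (res R M)))) N i.

Definition TateExt_pre M M' (f : {linear M' -> M}) N i :
    {additive TateExt M N i -> TateExt M' N i} :=
  Hhom_pre (fmap e (fmap (res R) (f : @hom (Mod A) M' M))) N i.

Definition TateExt_post M N N' (g : {linear N -> N'}) i :
    {additive TateExt M N i -> TateExt M N' i} :=
  Hhom_post (sval (sval (e (res R M)))) g i.

End Tate.

Definition ExtG M (G : gp_resolution M) N i : zmodType := Hhom G N i.

(* The functoriality of Ext_G in M: a homomorphism f : M' -> M acts through   *)
(* any chain map of resolutions lifting f.                                    *)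
Definition ExtG_pre M M' (G : gp_resolution M) (G' : gp_resolution M')
    (phi : chmap G' G) N i : {additive ExtG G N i -> ExtG G' N i} :=
  Hhom_pre phi N i.

Definition ExtG_post M (G : gp_resolution M) N N' (g : {linear N -> N'}) i :
    {additive ExtG G N i -> ExtG G N' i} :=
  Hhom_post G g i.

End Ext.

Definition exact_pair (U V W : zmodType) (f : {additive U -> V})
    (g : {additive V -> W}) : Prop :=
  forall y : V, g y = 0 <-> exists x : U, f x = y.

(* Main.v *)
From HB Require Import structures.
Require Import Defs.
From mathcomp Require Import all_boot all_order all_algebra.
From mathcomp Require Import boolp.

Set Implicit Arguments.
Unset Strict Implicit.
Unset Printing Implicit Defensive.

Import Order.TTheory GRing.Theory Num.Theory.
Local Open Scope ring_scope.

(* Let P = res M, let T = e^! P, and let C be the mapping cone of the counit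
   eps : T -> P. Every chain map from a complex in E(A) to C is null-homotopic,
   because E(A) is closed under shifts and eps induces bijections
   Hom_K(E, T) = Hom_K(E, P). Since T is exact, the cohomology of C is M, in
   degree 0, and its truncation
     ... -> P^-2 + T^-1 -> P^-1 + T^0 -> P^0 + Z^1(T) -> 0
   is a Gorenstein projective resolution of M, proper by the null-homotopy
   property. The triangle T -> P -> C then yields the long exact sequence; in
   degree 1, injectivity comes from replacing C^0 by its cycles. Any other
   Gorenstein projective resolution is homotopy equivalent to this one. *)

(** A Gorenstein projective module X is a module of cycles of some E in E(A), so suitable maps out
    of X extend to chain maps out of E: to the right because Hom(E, Q) is exact for Q projective, to
    the left because the terms of E are projective and the target is exact in low degrees. This
    turns null-homotopies on E into liftings on X through the differentials of C. The stage X -> M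
    escapes that argument, M not being a term of C, and is reduced to a lifting into degree -1.

    Only for k < 0 does the truncation G split as G^k = P^k + T^(k+1), so the triangle argument
    starts in degree 1. There G^0 = P^0 + Z^1(T) helps: a cocycle T^0 -> N vanishes on B^0(T) =
    Z^0(T), hence descends to Z^1(T), and the Tate group of degree 0 contributes nothing to Ext_G^1.

    Naturality of the counit holds up to homotopy only, so a map of cones depends on a chosen
    homotopy; uniqueness of lifts between proper resolutions removes the choice on cohomology. *)

(** * Linear maps and lifting from projective modules *)

Section MkLinear.
Variables (A : pzRingType) (U V : lmodType A) (f : U -> V).
Hypothesis f_linear : linear f.

Definition lin_fun : U -> V := f.
HB.instance Definition _ := GRing.isLinear.Build A U V _ lin_fun f_linear.
Definition mk_linear : {linear U -> V} := lin_fun.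

End MkLinear.

Section LinearPair.
Variables (A : pzRingType) (U V W : lmodType A).
Variables (f : {linear U -> V}) (g : {linear U -> W}).

Fact pair_lin_is_linear : linear (fun x => (f x, g x) : (V * W)%type).
Proof. by move=> a x y; rewrite !linearP. Qed.
Definition pair_lin : {linear U -> (V * W)%type} :=
  mk_linear pair_lin_is_linear.

End LinearPair.

Section LinearTools.
Variable A : pzRingType.
Implicit Types U V W P : lmodType A.

Definition inl_lin U V : {linear U -> (U * V)%type} := pair_lin idfun \0.
Definition inr_lin U V : {linear V -> (U * V)%type} := pair_lin \0 idfun.

Lemma factor_surj U V W (s : {linear U -> V}) (f : {linear U -> W}) :
  surjective s -> (forall x, s x = 0 -> f x = 0) ->
  exists g : {linear V -> W}, forall x, g (s x) = f x.
Proof.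
move=> s_surj kerf; pose r y := sval (cid (s_surj y)).
have sr y : s (r y) = y by apply: (svalP (cid (s_surj y))).
have fE x y : s x = s y -> f x = f y.
  by move=> sxy; apply/eqP; rewrite -subr_eq0 -linearB kerf // linearB sxy
    subrr.
have fr_linear : linear (f \o r).
  by move=> a x y /=; rewrite -linearP; apply: fE; rewrite linearP !sr.
by exists (mk_linear fr_linear) => x; apply: fE; rewrite sr.
Qed.

Lemma kermodP U V (f : {linear U -> V}) (x : kermod f) : f (kerval x) = 0.
Proof. by apply/eqP; apply: (valP x). Qed.

(** The pullback of [s] along [f] maps onto [P], and a section of that projection gives [g]. Since
    [s] need not be surjective it can be a differential, with exactness supplying the preimages. *)
Lemma proj_lift P U V (s : {linear U -> V}) (f : {linear P -> V}) :
  projective P -> (forall x, exists u, s u = f x) ->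
  exists g : {linear P -> U}, forall x, s (g x) = f x.
Proof.
move=> projP fim; have h_linear : linear (fun z : (P * U)%type =>
  f z.1 - s z.2).
  by move=> a x y /=; rewrite !linearP [in RHS]scalerDr addrACA.
pose h := mk_linear h_linear.
have pr_surj : surjective (fst \o (val : {linear kermod h -> (P * U)%type})
   : {linear kermod h -> P}).
  move=> x; have [u su] := fim x.
  have hx : (x, u) \in ker_pred h by rewrite unfold_in /= /lin_fun /= su subrr.
  by exists (Kermod hx).
have [t tE] := projP _ _ _ idfun pr_surj.
exists (snd \o (val : {linear kermod h -> (P * U)%type}) \o t) => x /=.
by have := kermodP (t x); rewrite /= /lin_fun => /subr0_eq <-; congr (f _);
  apply: tE.
Qed.

Lemma projective_retract P V (i : {linear V -> P}) (r : {linear P -> V}) :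
  cancel i r -> projective P -> projective V.
Proof.
move=> irK projP U W s f s_surj; have [g gE] := projP _ _ s (f \o r) s_surj.
by exists (g \o i) => x /=; rewrite [LHS]gE /= irK.
Qed.

Lemma projective_prod U V : projective U -> projective V ->
  projective (U * V)%type.
Proof.
move=> projU projV X Y s f s_surj.
have [g gE] := projU _ _ s (f \o inl_lin U V) s_surj.
have [h hE] := projV _ _ s (f \o inr_lin U V) s_surj.
have k_linear : linear (fun z : (U * V)%type => g z.1 + h z.2).
  by move=> a x y /=; rewrite !linearP addrACA scalerDr.
exists (mk_linear k_linear) => -[x y] /=.
rewrite /= /lin_fun linearD /=.
have /= -> := gE x; have /= -> := hE y.
by rewrite -linearD; congr (f (_, _)); rewrite /lin_fun /= ?addr0 ?add0r.
Qed.

End LinearTools.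

(** * Two-sided dependent choice along the integers *)

Section IntChoice.

Let up_pred (n : nat) : int := if n is n'.+1 then Posz n' else Negz 0.
Let down_succ (n : nat) : int := if n is n'.+1 then Negz n' else Posz 0.

Let up_predK n : up_pred n + 1 = Posz n.
Proof. by case: n => [|n] //=; rewrite -PoszD addn1. Qed.

Let down_succE n : Negz n + 1 = down_succ n.
Proof. by case: n => [|n] //=; rewrite !NegzE -[n.+2]addn1 PoszD opprD addrNK.
Qed.

(** The relation [Q] links neighbours, so each tower carries a pair; the upward and the downward
    tower grow from the same seed in degrees -1 and 0. There the constructors [Negz] and [Posz]
    meet, so [g] is defined by cases without transport. *)
Lemma int_choice0 (T : int -> Type)
    (Q : forall m k : int, m + 1 = k -> T m -> T k -> Prop)
    (h0 : Negz 0 + 1 = 0) (a0 : T (Negz 0)) (b0 : T 0) :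
  Q _ _ h0 a0 b0 ->
  (forall m k l (h : m + 1 = k) (h' : k + 1 = l), Negz 0 <= m ->
    forall a b, Q _ _ h a b -> exists c, Q _ _ h' b c) ->
  (forall m k l (h : m + 1 = k) (h' : k + 1 = l), k <= Negz 0 ->
    forall b c, Q _ _ h' b c -> exists a, Q _ _ h a b) ->
  exists2 g : forall m, T m,
    forall m k (h : m + 1 = k), Q _ _ h (g m) (g k) & g 0 = b0.
Proof.
move=> Q0 up down.
have up_ge n : Negz 0 <= up_pred n by case: n.
have down_le n : Negz n <= Negz 0 by [].
have u0 : Q _ _ (up_predK 0) a0 b0 by rewrite (eq_irrelevance (up_predK 0) h0).
have d0 : Q _ _ (down_succE 0) a0 b0.
  by rewrite (eq_irrelevance (down_succE 0) h0).
pose upt n := {ab : T (up_pred n) * T (Posz n) | Q _ _ (up_predK n) ab.1 ab.2}.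
pose downt n :=
  {ab : T (Negz n) * T (down_succ n) | Q _ _ (down_succE n) ab.1 ab.2}.
pose u : forall n, upt n := nat_rect upt (exist _ (a0, b0) u0)
  (fun n v => exist _ (_, _)
    (svalP (cid (up _ _ _ (up_predK n) (up_predK n.+1) (up_ge n) _ _
      (svalP v))))).
pose d : forall n, downt n := nat_rect downt (exist _ (a0, b0) d0)
  (fun n v => exist _ (_, _)
    (svalP (cid (down _ _ _ (down_succE n.+1) (down_succE n) (down_le n) _ _
      (svalP v))))).
pose g (m : int) : T m := match m with
  | Posz n => (sval (u n)).2
  | Negz n => (sval (d n)).1 end.
exists g => // -[n|n] k h.
  have ek : k = n.+1 by rewrite -h -PoszD addn1.
  by move: h; rewrite ek => h; rewrite (eq_irrelevance h (up_predK n.+1));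
    apply: (svalP (u n.+1)).
have ek : k = down_succ n by rewrite -h.
move: h; rewrite ek => h; rewrite (eq_irrelevance h (down_succE n)).
have -> : g (down_succ n) = (sval (d n)).2 by case: (n).
exact: (svalP (d n)).
Qed.

Lemma int_choice (T : int -> Type)
    (Q : forall m k : int, m + 1 = k -> T m -> T k -> Prop)
    (i j : int) (hij : i + 1 = j) (a0 : T i) (b0 : T j) :
  Q _ _ hij a0 b0 ->
  (forall m k l (h : m + 1 = k) (h' : k + 1 = l), i <= m ->
    forall a b, Q _ _ h a b -> exists c, Q _ _ h' b c) ->
  (forall m k l (h : m + 1 = k) (h' : k + 1 = l), k <= i ->
    forall b c, Q _ _ h' b c -> exists a, Q _ _ h a b) ->
  exists2 g : forall m, T m,
    forall m k (h : m + 1 = k), Q _ _ h (g m) (g k) & g j = b0.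
Proof.
have [c ej ei] : exists2 c, j = 0 + c & i = Negz 0 + c.
  by exists j; rewrite ?add0r // -hij addrC -addrA addr0.
move: hij a0 b0; subst i j => hij a0 b0 Q0 up down.
have shift m k : m + 1 = k -> m + c + 1 = k + c by move=> <-; rewrite addrAC.
have h0 : Negz 0 + 1 = 0 by [].
have [|||g' Qg' g'0] := @int_choice0 (fun m => T (m + c))
  (fun m k h => Q _ _ (shift m k h)) h0 a0 b0.
- by rewrite (eq_irrelevance (shift _ _ h0) hij).
- by move=> m k l h h' mi a b; apply: up; rewrite lerD2r.
- by move=> m k l h h' mi a b; apply: down; rewrite lerD2r.
(* [g] is [g'] shifted by [c]; [gE] allows any name [m + c] for the degree [n], so that every
   transport reduces to [erefl]. *)
pose tr n m (e : m + c = n) (x : T (m + c)) : T n :=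
  match e in _ = n return T n with erefl => x end.
pose g n := tr n (n - c) (subrK c n) (g' (n - c)).
have gE n m (e : m + c = n) : g n = tr n m e (g' m).
  have em : n - c = m by rewrite -e addrK.
  rewrite /g; move: (subrK c n); rewrite em => e'.
  by rewrite (eq_irrelevance e' e).
exists g; last by rewrite (gE _ 0 erefl).
move=> n k h; pose em := subrK c n; pose ek := subrK c k.
rewrite (gE _ _ em) (gE _ _ ek).
have hm : n - c + 1 = k - c by rewrite -h addrAC.
move: em ek hm; move: (n - c) (k - c) => m' k' em ek hm.
move: h; subst n k => h /=; rewrite (eq_irrelevance h (shift _ _ hm));
  exact: Qg'.
Qed.

End IntChoice.

(** * Totally acyclic complexes and Gorenstein projective modules *)

Section Acyclic.
Variable A : pzRingType.
Implicit Types (X Y E : complex A) (M N Q : lmodType A).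

Definition cast_degree X i j (e : i = j) : {linear X i -> X j} :=
  match e in _ = j return {linear X i -> X j} with erefl => idfun end.

(** The form of exactness of [homc E Q] that serves to extend maps, in the degrees of [E] rather
    than their opposites. *)
Definition hom_exact E Q : Prop :=
  forall (i j k : int) (h : i + 1 = j) (h' : j + 1 = k) (u : {linear E j -> Q}),
    (forall x, u (cd E h x) = 0) ->
    exists v : {linear E k -> Q}, forall x, v (cd E h' x) = u x.

Lemma homc_exactP E Q : zexact (homc E Q) <-> hom_exact E Q.
Proof.
split=> [exE i j k|exE j i k h h' u u0].
  rewrite -[i]opprK -[j]opprK -[k]opprK.
  move: (- i) (- j) (- k) => i' j' k' h h' u u0.
  have hk : k' + 1 = j' by rewrite -[k']opprK -h' opprD opprK addrNK.
  have hj : j' + 1 = i' by rewrite -[j']opprK -h opprD opprK addrNK.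
  have [|v vE] := exE j' k' i' hk hj u.
    by apply: linear_ext => x; rewrite /= (eq_irrelevance (homc_degree hj) h).
  exists v => x; rewrite -vE /= /homc_d_fun /=.
  by rewrite (eq_irrelevance (homc_degree hk) h').
have [x|v vE] := exE _ _ _ (homc_degree h') (homc_degree h) u.
  by move/(congr1 (fun w : {linear _ -> _} => w x)): u0.
by exists v; apply: linear_ext => x; apply: vE.
Qed.

Lemma totally_acyclicP E : totally_acyclic E <->
  [/\ forall i, projective (E i), forall i, exact_at E i
    & forall Q, projective Q -> hom_exact E Q].
Proof.
by split=> -[pE exE hE]; split=> // Q pQ; apply/homc_exactP; apply: hE.
Qed.

(** This presents [M] as Z^j(E). Unlike an isomorphism with a [kermod], it fixes no name for the
    degree j + 1 and so passes easily to shifts. *)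
Definition cycle_embedding M E j (f : {linear M -> E j}) : Prop :=
  injective f /\
  forall k (h : j + 1 = k) y, cd E h y = 0 <-> exists x, f x = y.

End Acyclic.

Section ShiftComplex.
Variables (A : pzRingType) (E : complex A) (n : int).

Fact shift_degree (i j : int) : i + 1 = j -> i + n + 1 = j + n.
Proof. by move=> <-; rewrite addrAC. Qed.

Fact shift_dd (i j k : int) (h : i + 1 = j) (h' : j + 1 = k) (x : E (i + n)) :
  (\- (cd E (shift_degree h'))) ((\- (cd E (shift_degree h))) x) = 0.
Proof. by rewrite /= linearN opprK cdd. Qed.

(** The sign is -1 for every [n]: this is the usual shift for n = 1, and total acyclicity does not
    depend on it. *)
Definition shiftc : complex A :=
  @Complex A (fun i => E (i + n))
    (fun i j h => \- (cd E (shift_degree h)) : {linear _ -> _}) shift_dd.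

Lemma shiftc_acyclic : totally_acyclic E -> totally_acyclic shiftc.
Proof.
move=> /totally_acyclicP[pE exE hE]; apply/totally_acyclicP;
  split=> [i|j i k h h' y /= dy|Q pQ i j k h h' u u0].
- exact: pE.
- have /eqP := dy; rewrite oppr_eq0 => /eqP {}dy.
  have [x xy] := exE _ _ _ (shift_degree h) (shift_degree h') y dy.
  by exists (- x); rewrite /= linearN opprK.
- have [x|v vE] := hE Q pQ _ _ _ (shift_degree h) (shift_degree h') u.
    by have /= := u0 (- x); rewrite linearN opprK.
  exists (\- v : {linear _ -> _}) => x; rewrite /= linearN opprK; exact: vE.
Qed.

End ShiftComplex.

Section ProductComplex.
Variables (A : pzRingType) (E F : complex A).

Definition prod_d (i j : int) (h : i + 1 = j) :
    {linear (E i * F i)%type -> (E j * F j)%type} :=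
  pair_lin (cd E h \o fst) (cd F h \o snd).

Fact prod_dd (i j k : int) (h : i + 1 = j) (h' : j + 1 = k)
  (x : (E i * F i)%type) :
  prod_d h' (prod_d h x) = 0.
Proof. by rewrite /prod_d /= /lin_fun /= !cdd. Qed.

Definition prodc : complex A := Complex prod_dd.

Lemma prodc_acyclic : totally_acyclic E -> totally_acyclic F ->
  totally_acyclic prodc.
Proof.
move=> /totally_acyclicP[pE exE hE] /totally_acyclicP[pF exF hF].
apply/totally_acyclicP; split=> [i|j i k h h' [x y]|Q pQ i j k h h' u u0].
- exact: projective_prod.
- move=> [dx dy]; have [x' dx'] := exE _ _ _ h h' _ dx.
  by have [y' dy'] := exF _ _ _ h h' _ dy; exists (x', y'); rewrite -dx' -dy'.
- have [x|v vE] := hE Q pQ _ _ _ h h' (u \o inl_lin (E j) (F j)).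
    rewrite /= /lin_fun /=; have := u0 (x, 0).
    by rewrite /= /prod_d /= /lin_fun /= linear0.
  have [x|w wE] := hF Q pQ _ _ _ h h' (u \o inr_lin (E j) (F j)).
    rewrite /= /lin_fun /=; have := u0 (0, x).
    by rewrite /= /prod_d /= /lin_fun /= linear0.
  exists (linear_add (v \o fst) (w \o snd)) => -[x y].
  rewrite /= /lin_fun /= vE wE /= /lin_fun /= -linearD.
  by congr (u (_, _)); rewrite /= ?addr0 ?add0r.
Qed.

End ProductComplex.

Section DiskComplex.
Variables (A : pzRingType) (Q : lmodType A).

Definition disk_d : {linear (Q * Q)%type -> (Q * Q)%type} := pair_lin snd \0.

(* The sum of all shifts of Q = Q, so that no case split on the degree is
   needed. *)
Definition diskc : complex A :=
  @Complex A (fun=> (Q * Q)%type) (fun i j h => disk_d) (fun i j k h h' x =>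
    erefl).

Lemma diskc_acyclic : projective Q -> totally_acyclic diskc.
Proof.
move=> pQ; apply/totally_acyclicP.
split=> [i|j i k h h' [x y] [dy]|P pP i j k h h' u u0].
- exact: projective_prod.
- by exists (0, x); move: dy; rewrite /= /disk_d /= /lin_fun /= => ->.
- exists (u \o pair_lin \0 fst) => -[x y]; rewrite /= /disk_d /= /lin_fun /=.
  have := u0 (0, x); rewrite /= /disk_d /= /lin_fun /= => ux.
  by rewrite -[RHS]subr0 -ux -linearB; congr (u (_, _));
    rewrite /= ?subrr ?subr0.
Qed.

End DiskComplex.

Section GorensteinProjective.
Variable A : pzRingType.
Implicit Types (M Q : lmodType A) (E : complex A).

(** The definition places the module in degree 1; shifting by 1 - j moves it to degree j. *)
Lemma gorenstein_projective_at M (j : int) : gorenstein_projective M ->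
  exists2 E, totally_acyclic E & exists f : {linear M ->
    E j}, cycle_embedding f.
Proof.
case=> E acE [f f_bij]; exists (shiftc E (1 - j)); first exact: shiftc_acyclic.
have [g [g_inj gP]] : exists g : {linear M -> E (j + (1 - j))},
  cycle_embedding g.
  have -> : j + (1 - j) = 1 by rewrite addrC subrK.
  exists ((val : {linear kermod _ -> _}) \o f); split=> [|k h y].
    by apply: inj_comp (bij_inj f_bij); apply: val_inj.
  subst k; split=> [dy|[x <-]]; last exact: kermodP.
  have yK : y \in ker_pred (cd E (erefl 2 : 1 + 1 = 2)) by apply/eqP.
  have [f' _ fK] := f_bij.
  by exists (f' (Kermod yK)); rewrite /= fK.
exists g; split=> // k h y; rewrite -(gP _ (shift_degree (1 - j) h)) /=.
by split=> [/eqP|->]; rewrite ?oppr0 // oppr_eq0 => /eqP.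
Qed.

Lemma gorenstein_projectiveI M E (f : {linear M -> E 1}) :
  totally_acyclic E -> cycle_embedding f -> gorenstein_projective M.
Proof.
move=> acE [f_inj fP]; exists E => //.
have f0 x : cd E (erefl 2 : 1 + 1 = 2) (f x) = 0 by apply/fP; exists x.
exists (corestr f0).
have surj (y : kermod (cd E (erefl 2 : 1 + 1 = 2))) : exists x, f x = kerval y.
  by apply/(fP _ (erefl 2 : 1 + 1 = 2)); apply: kermodP.
exists (fun y => sval (cid (surj y))) => [x|y].
  by apply: f_inj; rewrite (svalP (cid (surj _))).
by apply: val_inj; rewrite /= (svalP (cid (surj y))).
Qed.

Lemma projective_gorenstein Q : projective Q -> gorenstein_projective Q.
Proof.
move=> pQ; apply: (@gorenstein_projectiveI _ (diskc Q) (inl_lin Q Q)).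
  exact: diskc_acyclic.
split=> [x y []//|k h [x y]]; split=> [[->]|[z [_ <-]]] //.
by exists x.
Qed.

End GorensteinProjective.

(** * Mapping cones *)

Section ChainExtension.
Variables (A : pzRingType) (E C : complex A).
Implicit Types (M : lmodType A) (i j k m : int).

Lemma cycle_cover M j k (h : j + 1 = k) (f : {linear M -> E k}) :
  totally_acyclic E -> cycle_embedding f ->
  exists2 p : {linear E j -> M}, forall x, f (p x) = cd E h x & surjective p.
Proof.
move=> [pE exE _] [f_inj fP].
have [x|p pE'] := @proj_lift _ _ _ _ f (cd E h) (pE j).
  by apply/(fP _ erefl); rewrite cdd.
exists p => // x; have [|y dy] := exE _ _ _ h erefl (f x).
  by apply/fP; exists x.
by exists y; apply: f_inj; rewrite pE'.
Qed.

Lemma chain_extension M i (g : {linear M -> E (i + 1)})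
    (f : {linear M -> C (i + 1)}) :
  totally_acyclic E -> (forall m, projective (C m)) ->
  (forall m, m <= i -> exact_at C m) -> cycle_embedding g ->
  (forall x, exists y, cd C (erefl (i + 1)) y = f x) ->
  exists F : chmap E C, forall x, F (i + 1) (g x) = f x.
Proof.
move=> acE pC exC gE fim; have [p gp p_surj] :=
  cycle_cover (erefl (i + 1)) acE gE.
have [pE exE hE] := (totally_acyclicP E).1 acE; have [g_inj gP] := gE.
(* Both maps come from [f \o p]: [a0] lifts it through the differential of [C], [b0] extends it
   along that of [E]. They form the commuting square from which the choice starts. *)
have [x|a0 a0E] := @proj_lift _ _ _ _ (cd C (erefl (i + 1))) (f \o p) (pE i).
  exact: fim.
have [x|b0 b0E] := hE _ (pC (i + 1)) _ _ _ (subrK 1 i) (erefl (i + 1)) (f \o p).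
  rewrite /=; suff -> : p (cd E (subrK 1 i) x) = 0 by rewrite linear0.
  by apply: g_inj; rewrite gp cdd linear0.
pose T m := {linear E m -> C m}.
pose Q m k (h : m + 1 = k) (a : T m) (b : T k) :=
  forall x, b (cd E h x) = cd C h (a x).
have [|||F FQ Fb0] := @int_choice T Q i (i + 1) erefl a0 b0.
- by move=> x; rewrite b0E -a0E.
- move=> m k l h h' _ a b ab.
  have [x|c cE] := hE _ (pC l) _ _ _ h h' (cd C h' \o b).
    by rewrite /= ab cdd.
  by exists c => x; rewrite cE.
- move=> m k l h h' ki b c bc.
  have [x|a aE] := @proj_lift _ _ _ _ (cd C h) (b \o cd E h) (pE m).
    by apply: (exC _ ki _ _ h h'); rewrite /= -bc cdd linear0.
  by exists a => x; rewrite aE.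
exists (ChMap FQ) => x /=; rewrite Fb0.
by have [y <-] := p_surj x; rewrite gp b0E.
Qed.

End ChainExtension.

Section Unshift.
Variables (A : pzRingType) (X Y : complex A).
Variable a : forall m, {linear X (m + 1) -> Y (m + 1)}.
Hypothesis ad : forall m k (h : m + 1 = k) x,
  a k (cd X (shift_degree 1 h) x) = cd Y (shift_degree 1 h) (a m x).

(** A degree [n] is (n - 1) + 1 only up to transport, whereas the T-component of a map into the cone
    is given in degrees m + 1. *)
Lemma unshift : exists F : chmap X Y, forall m x, F (m + 1) x = a m x.
Proof.
pose tr n m (e : m + 1 = n) : {linear X n -> Y n} :=
  match e in _ = n return {linear X n -> Y n} with erefl => a m end.
pose F n := tr n (n - 1) (subrK 1 n).
have FE n m (e : m + 1 = n) : F n = tr n m e.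
  have em : n - 1 = m by rewrite -e addrK.
  rewrite /F; move: (subrK 1 n); rewrite em => e'.
  by rewrite (eq_irrelevance e' e).
have Fd n k (h : n + 1 = k) x : F k (cd X h x) = cd Y h (F n x).
  pose en := subrK 1 n; pose ek := subrK 1 k; rewrite (FE _ _ en) (FE _ _ ek).
  have hm : n - 1 + 1 = k - 1 by rewrite -h addrAC.
  move: en ek hm; move: (n - 1) (k - 1) => m l en ek hm.
  move: h x; subst n k => h x /=.
  by rewrite (eq_irrelevance h (shift_degree 1 hm)) ad.
by exists (ChMap Fd) => m x /=; rewrite (FE _ m erefl).
Qed.

End Unshift.

Section Cone.
Variables (A : pzRingType) (T P : complex A) (eps : chmap T P).

Definition cone_d (i j : int) (h : i + 1 = j) :
    {linear (P i * T (i + 1)%R)%type -> (P j * T (j + 1)%R)%type} :=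
  pair_lin (linear_add (cd P h \o fst) (cast_degree P h \o (eps (i + 1) \o
    snd)))
    ((\- cd T (shift_degree 1 h)) \o snd).

Fact cone_dd (i j k : int) (h : i + 1 = j) (h' : j + 1 = k)
  (x : (P i * T (i + 1)%R)%type) : cone_d h' (cone_d h x) = 0.
Proof.
subst j k; rewrite /cone_d /= /lin_fun /=.
rewrite linearD cdd add0r linearN -chmapd [in X in (_, X)]linearN cdd !oppr0.
by rewrite (eq_irrelevance (shift_degree 1 erefl) (erefl (i + 1 + 1))) subrr.
Qed.

Definition cone : complex A := Complex cone_dd.

Lemma cone_dE i p t : cd cone (erefl (i + 1)) (p, t) =
  (cd P (erefl (i + 1)) p + eps (i + 1) t, - cd T (erefl (i + 1 + 1)) t).
Proof.
by rewrite /= /cone_d /= /lin_fun /=; congr (_, - cd T _ _);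
  apply: eq_irrelevance.
Qed.

Lemma cone_projective : (forall i, projective (P i)) ->
  (forall i, projective (T i)) -> forall i, projective (cone i).
Proof. by move=> pP pT i; apply: projective_prod. Qed.

Lemma cone_exact i : exact_at P i -> (forall m, exact_at T m) ->
  exact_at cone i.
Proof.
move=> exP exT j k h h' [p t]; subst k; subst i.
rewrite [zd _ _]cone_dE => -[dp dt].
have [|t' t'E] := exT _ _ _ erefl erefl t.
  by apply/eqP; rewrite -oppr_eq0; apply/eqP.
have [|p' p'E] := exP _ _ erefl erefl (p + eps (j + 1) t').
  by rewrite /= linearD -chmapd [cd T _ _]t'E.
exists (p', - t'); rewrite [LHS]cone_dE [cd P _ _]p'E.
by rewrite !linearN opprK addrK; congr (_, _).
Qed.

End Cone.

Section ConeLift.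
Variables (A : pzRingType) (T P : complex A) (eps : chmap T P).
Implicit Types (M : lmodType A) (i j k m : int).
Hypotheses (pP : forall i, projective (P i)) (acT : totally_acyclic T).
Hypothesis eps_onto : forall (E : complex A) (g : chmap E P),
  totally_acyclic E -> exists f : chmap E T, homotopic g (chmap_comp eps f).
Hypothesis eps_inj : forall (E : complex A) (f f' : chmap E T),
  totally_acyclic E -> homotopic (chmap_comp eps f) (chmap_comp eps f') ->
  homotopic f f'.

Definition zero_chmap (X Y : complex A) : chmap X Y.
Proof. by refine (@ChMap A X Y (fun=> \0) _) => i j h x; rewrite /= linear0.
Defined.

(* A map from Z^(i+2)(E) to the boundaries of degree i + 1 extends to a chain
   map from the shift of E to the cone; the lift is the restriction to the
   cycles of a null-homotopy, assembled from two applications of the hypotheses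
   on eps. *)
Lemma cone_lift M i (f : {linear M -> cone eps (i + 1)}) :
  gorenstein_projective M -> (forall m, m <= i -> exact_at P m) ->
  (forall x, exists y, cd (cone eps) (erefl (i + 1)) y = f x) ->
  exists g : {linear M -> cone eps i},
    forall x, cd (cone eps) (erefl (i + 1)) (g x) = f x.
Proof.
move=> /(gorenstein_projective_at (i + 1 + 1))[E acE [g gE]] exP fim.
have [pT exT _] := acT; have acE1 := shiftc_acyclic 1 acE.
pose g' : {linear M -> shiftc E 1 (i + 1)} := g.
have gd k (h : i + 1 + 1 + 1 = k) x : cd E h (g x) = 0.
  by apply/gE.2; exists x.
have g'E : cycle_embedding g'.
  split; first exact: gE.1.
  move=> k h y; rewrite -(gE.2 _ (shift_degree 1 h)) /=.
  by split=> [/eqP|->]; rewrite ?oppr0 // oppr_eq0 => /eqP.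
have [|m mi|F FE] := chain_extension (C := cone eps) acE1 _ _ g'E fim.
- exact: cone_projective.
- by apply: cone_exact => //; apply: exP.
pose s m : {linear E (m + 1) -> P m} := fst \o F m.
pose tau m : {linear E (m + 1) -> T (m + 1)} := snd \o F m.
have Fd m x : F (m + 1) (- cd E (shift_degree 1 (erefl (m + 1))) x) =
    cd (cone eps) erefl (s m x, tau m x).
  by rewrite -[(_, _)]surjective_pairing; apply: (chmapd F (erefl (m + 1)) x).
(* The two components of the cone differential: [taud] makes [tau] a chain map E -> T, and [sd]
   makes [- s] a null-homotopy of its composite with [eps]. *)
have sd m x : s (m + 1) (cd E (erefl (m + 1 + 1)) x) =
    - (cd P (erefl (m + 1)) (s m x) + eps (m + 1) (tau m x)).
  have /(congr1 (fun z => - z.1)) := Fd m x; rewrite cone_dE => <-.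
  by rewrite linearN opprK (eq_irrelevance (shift_degree 1 erefl) (erefl (m + 1
    + 1))).
have taud m x : tau (m + 1) (cd E (erefl (m + 1 + 1)) x) =
    cd T (erefl (m + 1 + 1)) (tau m x).
  have /(congr1 (fun z => - z.2)) := Fd m x; rewrite cone_dE opprK => <-.
  by rewrite linearN opprK (eq_irrelevance (shift_degree 1 erefl) (erefl (m + 1
    + 1))).
have fE x : f x = (s (i + 1) (g x), tau (i + 1) (g x)).
  by rewrite -FE -surjective_pairing.
clearbody s tau; clear Fd.
have [m k h x|tau' tau'E] := @unshift _ E T tau.
  by subst k; rewrite (eq_irrelevance (shift_degree 1 erefl) (erefl (m + 1 +
    1))) taud.
have [|sg sgE] := @eps_inj E tau' (zero_chmap E T) acE.
  pose S m j (h : m + 1 = j) : {linear E j -> P m} :=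
    match h in _ = j return {linear E j -> P m} with erefl => \- s m end.
  exists S => m j k h h' x; subst j k.
  by rewrite /= linear0 subr0 tau'E sd linearN opprK addrA addNr add0r.
have {}sgE m x : tau m x = cd T (erefl (m + 1)) (sg m (m + 1) erefl x) +
    sg (m + 1) (m + 1 + 1) erefl (cd E (erefl (m + 1 + 1)) x).
  by rewrite -sgE /= subr0 tau'E.
(* There are now two contractions of [eps] after [tau], namely [- s] and [eps] after [sg]. Up to
   sign [r] is their difference, hence a chain map from the shift of E to P. *)
pose r m : {linear shiftc E 1 m -> P m} :=
  linear_add (s m) (eps m \o sg m (m + 1) erefl).
have rd m k (h : m + 1 = k) x : r k (cd (shiftc E 1) h x) = cd P h (r m x).
  subst k; rewrite /= (eq_irrelevance (shift_degree 1 erefl) (erefl (m + 1 +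
    1))).
  rewrite !linearN sd opprK sgE !linearD -!chmapd /=.
  by rewrite -!addrA subrr addr0.
have [ka [om omE]] := @eps_onto _ (ChMap rd) acE1.
(* Since [om] is a homotopy from [r] to [eps] after [ka], the pair (om, ka - sg) contracts the map
   to the cone; its terms involving the differential of E vanish on the cycles [g x]. *)
exists (pair_lin (om i (i + 1) erefl)
  (linear_add (ka (i + 1)) (\- sg (i + 1) (i + 1 + 1) erefl)) \o g) => x.
have gd0 : cd E (erefl (i + 1 + 1 + 1)) (g x) = 0 by exact: gd.
rewrite fE [LHS]cone_dE; congr (_, _).
- have := omE i (i + 1) (i + 1 + 1) erefl erefl (g x).
  rewrite /= (eq_irrelevance (shift_degree 1 erefl) (erefl (i + 1 + 1 + 1)))
    gd0.
  rewrite oppr0 linear0 addr0 => <-.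
  by rewrite linearD linearN /= addrA subrK addrK.
- have := chmapd ka (erefl (i + 1 + 1)) (g x).
  rewrite /= (eq_irrelevance (shift_degree 1 erefl) (erefl (i + 1 + 1 + 1)))
    gd0.
  rewrite oppr0 linear0 => kd.
  by rewrite linearD linearN /= -kd add0r opprK sgE gd0 linear0 addr0.
Qed.

End ConeLift.

(** * The truncated cone as a Gorenstein projective resolution *)

Section Truncation.
Variables (A : pzRingType) (X : complex A).
Implicit Types i j k : int.

(* Its kernel is X^i for i < 0, the cycles for i = 0, and 0 for i > 0. *)
Definition trunc_test i : {linear X i -> (X (i + 1)%R * X i)%type} :=
  pair_lin (if i < 0 then linear_zero _ _ else cd X (erefl (i + 1)))
           (if 0 < i then idfun : {linear _ -> _} else linear_zero _ _).

Lemma trunc_testP i (x : X i) : trunc_test i x = 0 <->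
  (0 <= i -> forall j (h : i + 1 = j), cd X h x = 0) /\ (0 < i -> x = 0).
Proof.
rewrite /trunc_test /= /lin_fun; split.
  case: ltP => [i0 [x0]|i0 [dx x0]]; split.
  - by [].
  - by move=> i1; rewrite i1 in x0.
  - by move=> _ j h; subst j.
  - by move=> i1; rewrite i1 in x0.
case=> d0 x0; congr (_, _); first by case: ltP => // /d0 ->.
by case: ifP => // /x0 ->.
Qed.

Fact trunc_d_subproof i j (h : i + 1 = j) (x : kermod (trunc_test i)) :
  trunc_test j (cd X h (kerval x)) = 0.
Proof.
apply/trunc_testP; split=> [_ k h'|j0]; first by rewrite cdd.
by apply: ((trunc_testP _).1 (kermodP x)).1; rewrite -ltzD1 h.
Qed.

Definition trunc_d i j (h : i + 1 = j) :
    {linear kermod (trunc_test i) -> kermod (trunc_test j)} :=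
  corestr (g := cd X h \o (val : {linear kermod _ -> _})) (trunc_d_subproof h).

Fact trunc_dd i j k (h : i + 1 = j) (h' : j + 1 = k)
  (x : kermod (trunc_test i)) :
  trunc_d h' (trunc_d h x) = 0.
Proof. by apply: val_inj; rewrite /= cdd. Qed.

Definition truncc : complex A := Complex trunc_dd.

Lemma truncc_gt0 i (x : truncc i) : 0 < i -> x = 0.
Proof. by move=> i0; apply: val_inj; apply: ((trunc_testP _).1 (kermodP x)).2.
Qed.

Lemma trunc_cycle i j (h : i + 1 = j) (x : truncc i) : 0 <= i ->
  cd X h (kerval x) = 0.
Proof. by move=> i0; apply: ((trunc_testP _).1 (kermodP x)).1. Qed.

Lemma trunc_surj i (x : X i) :
  (0 <= i -> forall j (h : i + 1 = j), cd X h x = 0) -> (0 < i -> x = 0) ->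
  exists y : truncc i, kerval y = x.
Proof.
move=> d0 x0; have xK : x \in ker_pred (trunc_test i).
  by apply/eqP/trunc_testP.
by exists (Kermod xK).
Qed.

Fact trunc_lt0_subproof i (i0 : i < 0) (x : X i) : trunc_test i (idfun x) = 0.
Proof.
by apply/trunc_testP; split=> [|/(lt_trans i0)]; rewrite ?ltxx // leNgt i0.
Qed.

Definition trunc_mk i (i0 : i < 0) : {linear X i -> truncc i} :=
  corestr (g := idfun) (trunc_lt0_subproof i0).

Lemma trunc_projective i : i < 0 -> projective (X i) -> projective (truncc i).
Proof.
move=> i0; apply: (@projective_retract _ _ _ (val : {linear kermod _ -> _})
  (trunc_mk i0)) => x.
exact: val_inj.
Qed.

Lemma trunc_exact i : i < 0 -> exact_at X i -> exact_at truncc i.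
Proof.
move=> i0 exX j k h h' y dy; have [|x xE] := exX _ _ h h' (kerval y).
  exact: (congr1 (fun z => kerval z) dy).
have j0 : j < 0 by apply: lt_trans i0; rewrite -h ltrDl.
by exists (trunc_mk j0 x); apply: val_inj.
Qed.

End Truncation.

Section TruncationLift.
Variables (A : pzRingType) (Y X : complex A) (f : chmap Y X).
Hypothesis f_cycle : forall i, 0 <= i -> forall j (h : i + 1 = j) x,
  cd X h (f i x) = 0.
Hypothesis f_gt0 : forall i, 0 < i -> forall x, f i x = 0.

Fact trunc_lift_subproof i x : trunc_test X i (f i x) = 0.
Proof. by apply/trunc_testP; split=> [i0 j h|i0];
  [apply: f_cycle | apply: f_gt0]. Qed.

Fact trunc_lift_d i j (h : i + 1 = j) x :
  corestr (trunc_lift_subproof (i := j)) (cd Y h x) =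
  cd (truncc X) h (corestr (trunc_lift_subproof (i := i)) x).
Proof. by apply: val_inj; rewrite /= chmapd. Qed.

Definition trunc_lift : chmap Y (truncc X) :=
  @ChMap A Y (truncc X) (fun i => corestr (trunc_lift_subproof (i := i)))
    trunc_lift_d.

End TruncationLift.

Section ConeStart.
Variables (A : pzRingType) (T P : complex A) (eps : chmap T P).
Hypothesis P_gt0 : forall i : int, 0 < i -> forall x : P i, x = 0.
Let G := truncc (cone eps).

Fact cone_start_subproof (z : (P 0 * T 0)%type) :
  trunc_test (cone eps) 0 (pair_lin fst (cd T (erefl (0 + 1)) \o snd) z) = 0.
Proof.
apply/trunc_testP; split=> // _ j h; subst j.
rewrite [LHS]cone_dE /= cdd oppr0; congr (_, _); exact: P_gt0.
Qed.

(** G^0 is P^0 + Z^1(T), and exactness makes Z^1(T) a quotient of T^0. Maps out of G^0 are defined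
    on P^0 + T^0 and pushed down along this surjection. *)
Definition cone_start : {linear (P 0 * T 0)%type -> G 0} :=
  corestr cone_start_subproof.

Lemma cone_start_d (i : int) (h : i + 1 = 0) (x : G i) : cd G h x = cone_start
  (cd P h (kerval x).1 + eps 0 (cast_degree T h (kerval x).2),
    - cast_degree T h (kerval x).2).
Proof.
have ei : i = Negz 0 by rewrite -[i](addrK 1) h.
subst i; case Ex : (kerval x) => [p t].
apply: val_inj; rewrite /= Ex (eq_irrelevance h (erefl (Negz 0 + 1))).
rewrite [LHS](cone_dE eps (i := Negz 0)).
by congr (_, _); rewrite [RHS]linearN.
Qed.

Lemma cone_start_surj : (forall i, exact_at T i) -> surjective cone_start.
Proof.
move=> exT y; have := trunc_cycle (erefl (0 + 1)) y (lexx 0).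
case Ey : (kerval y) => [p t]; rewrite cone_dE => /(congr1 (fun z => - z.2)).
rewrite /= opprK oppr0 => dt.
have [t0 t0E] := exT _ _ _ (erefl (0 + 1)) _ _ dt.
by exists (p, t0); apply: val_inj; rewrite /= Ey -t0E.
Qed.

End ConeStart.

Section ConeResolution.
Variables (A : pzRingType) (T P : complex A) (eps : chmap T P).
Hypotheses (pP : forall i, projective (P i)) (acT : totally_acyclic T).
Hypothesis eps_onto : forall (E : complex A) (g : chmap E P),
  totally_acyclic E -> exists f : chmap E T, homotopic g (chmap_comp eps f).
Hypothesis eps_inj : forall (E : complex A) (f f' : chmap E T),
  totally_acyclic E -> homotopic (chmap_comp eps f) (chmap_comp eps f') ->
  homotopic f f'.
Variables (M : lmodType A) (e : augmentation P M).
Hypothesis resP : resolution e.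

Let G := truncc (cone eps).

Let P_gt0 i : 0 < i -> forall x : P i, x = 0.
Proof. by case: resP => + _ _ _ i0 x; apply. Qed.

Let cone_start := cone_start eps P_gt0.

Let cone_start_surj : surjective cone_start.
Proof. by apply: cone_start_surj; case: acT. Qed.

(** Adding the boundary of (0, t) turns (p, d t) into (p + eps t, 0), whose class in H^0(P) = M is e
    (p + eps t). Another choice of [t] changes it by a boundary of T, which [eps] sends to a
    boundary of P and [e] then kills. *)
Fact cone_aug_exists : exists a : {linear G 0 -> M},
  forall z, a (cone_start z) = e (z.1 + eps 0 z.2).
Proof.
pose f : {linear (P 0 * T 0)%type -> M} := e \o linear_add fst (eps 0 \o snd).
have [[p t]|a aE] := @factor_surj _ _ _ _ cone_start f cone_start_surj.
  move/(congr1 (fun z => kerval z)) => -[-> dt] /=; rewrite add0r.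
  have [_ exT _] := acT; have [t' <-] := exT _ _ _ (subrK 1 0) (erefl (0 + 1)) t
    dt.
  by rewrite [eps _ _]chmapd aug_d.
by exists a => z; rewrite aE.
Qed.

Let a := sval (cid cone_aug_exists).

Lemma cone_aug_start z : a (cone_start z) = e (z.1 + eps 0 z.2).
Proof. exact: (svalP (cid cone_aug_exists)). Qed.

Fact cone_aug_d i (h : i + 1 = 0) (x : G i) : a (cd G h x) = 0.
Proof.
by rewrite cone_start_d [LHS]cone_aug_start /= linearN addrK aug_d.
Qed.

Definition cone_aug : augmentation G M := Augmentation cone_aug_d.

Lemma cone_augE (x : G 0) p t : kerval x = (p, cd T (erefl (0 + 1)) t) ->
  cone_aug x = e (p + eps 0 t).
Proof.
move=> xE; have -> : x = cone_start (p, t) by apply: val_inj.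
exact: cone_aug_start.
Qed.

Lemma cone_resolution_subproof : resolution cone_aug.
Proof.
have [_ e_surj e_ker exP] := resP; have [_ exT _] := acT.
split=> [i i0 x|m|i h y|i i0].
- exact: truncc_gt0.
- have [p <-] := e_surj m; exists (cone_start (p, 0)).
  by rewrite [LHS]cone_aug_start /= linear0 addr0.
- have [[p t] <-] := cone_start_surj y.
  rewrite [cone_aug _]cone_aug_start /= => /(e_ker _ h)[p' p'E].
  have ei : i = Negz 0 by rewrite -[i](addrK 1) h.
  (* The boundary of (p', - t) is (d p' - eps t, d t), where d p' = p + eps t. *)
  subst i; exists (trunc_mk (cone eps) (isT : Negz 0 < 0) (p', - t)).
  apply: val_inj; move: p'E; rewrite (eq_irrelevance h (erefl (Negz 0 + 1))) =>
    p'E.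
  rewrite [LHS](cone_dE eps (i := Negz 0)) /= p'E !linearN opprK addrK.
  by congr (_, _).
- by apply: trunc_exact => //; apply: cone_exact => //; apply: exP.
Qed.

(** Below degree 0 the terms are projective. In degree 0, P^0 + Z^1(T) is the module of degree 1
    cycles of the sum of T and the disk complex on P^0. *)
Lemma cone_gp i : i <= 0 -> gorenstein_projective (G i).
Proof.
have [pT _ _] := acT.
rewrite le_eqVlt => /orP[/eqP ->|i0]; last first.
  apply: projective_gorenstein; apply: trunc_projective => //.
  exact: cone_projective.
pose v : {linear G 0 -> (P 0 * T (0 + 1)%R)%type} := (val : {linear kermod _ ->
  _}).
apply: (@gorenstein_projectiveI _ _ (prodc T (diskc (P 0)))
  (pair_lin (snd \o v) (inl_lin _ _ \o (fst \o v)))).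
  by apply: prodc_acyclic => //; apply: diskc_acyclic.
split=> [x y [Et Ep]|k h [t [p q]]].
  apply: val_inj; rewrite [LHS]surjective_pairing [RHS]surjective_pairing.
  by congr (_, _).
subst k; split=> [[dt q0]|[x [<- <- <-]]].
  have [_ j h|//|x xE] := @trunc_surj A (cone eps) 0 (p, t).
    subst j; rewrite cone_dE; congr (_, _); first exact: P_gt0.
    by rewrite [cd T _ t]dt oppr0.
  by exists x; rewrite /= /lin_fun /= xE [q]q0.
congr (_, (_, _)).
have := trunc_cycle (erefl (0 + 1)) x (lexx 0).
by rewrite [kerval x]surjective_pairing cone_dE => /(congr1 (fun z => - z.2));
  rewrite /= opprK oppr0.
Qed.

Lemma cone_trunc_lift (X : lmodType A) (i j : int) (h : i + 1 = j)
  (f : {linear X -> G j}) : j <= 0 ->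
  gorenstein_projective X -> (forall x, exists y, cd G h y = f x) ->
  exists g : {linear X -> G i}, forall x, cd G h (g x) = f x.
Proof.
move=> j0 gpX fim; subst j; have i0 : i < 0 by apply: lt_le_trans j0;
  rewrite ltrDl.
have [_ _ _ exP] := resP.
have [m mi|x|g gE] := cone_lift pP acT eps_onto eps_inj
  (f := (val : {linear kermod _ -> _}) \o f) gpX.
- by apply: exP; apply: le_lt_trans i0.
- by have [y yE] := fim x; exists (kerval y); rewrite /= -yE.
- by exists (trunc_mk _ i0 \o g) => x; apply: val_inj; rewrite /= [LHS]gE.
Qed.

(* The lift b : E^1 -> G^0 of E^1 -> X -> M is corrected by d v, where v extends
   a lift to G^(-1) of the restriction of b to the cycles of E^1. *)
Lemma cone_proper_aug : gp_relative_epi cone_aug.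
Proof.
move=> X f /(gorenstein_projective_at (1 + 1))[E acE [g gE]].
have [_ a_surj a_ker _] := cone_resolution_subproof.
have [p gp p_surj] := cycle_cover (erefl (1 + 1)) acE gE.
have [pE exE hE] := (totally_acyclicP E).1 acE.
have [x|b bE] := @proj_lift _ _ _ _ cone_aug (f \o p) (pE 1);
  first exact: a_surj.
pose Z := kermod (cd E (erefl 2 : 1 + 1 = 2)).
pose iZ : {linear Z -> E 1} := (val : {linear kermod _ -> _}).
have gpZ : gorenstein_projective Z by exists E => //; exists idfun; exists id.
have pZ z : p (iZ z) = 0.
  by apply: gE.1; rewrite gp linear0; apply: kermodP.
have h : Negz 0 + 1 = 0 by [].
have [|x|l lE] := @cone_trunc_lift Z _ _ h (b \o iZ) _ gpZ => //.
  by apply: a_ker; rewrite [LHS]bE /= pZ linear0.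
have c0 x : cd E (erefl 2 : 1 + 1 = 2) (cd E (erefl (0 + 1)) x) = 0 by rewrite
  cdd.
pose c : {linear E 0 -> Z} := corestr (g := cd E (erefl (0 + 1))) c0.
have projG : projective (G (Negz 0)).
  by apply: trunc_projective => //; apply: cone_projective => //; case: acT.
(* [l \o c] is a cocycle of Hom(E, G^(-1)), and G^(-1) is projective, so it extends along the
   differential to E^1. *)
have [x|v vE] := hE _ projG _ _ _ (subrK 1 0) (erefl (0 + 1)) (l \o c).
  rewrite /=; suff -> : c (cd E (subrK 1 0) x) = 0 by rewrite linear0.
  by apply: val_inj; rewrite /= cdd.
have vZ z : v (iZ z) = l z.
  have [|y yE] := exE 1 _ _ (erefl (0 + 1)) (erefl 2 : 1 + 1 = 2) (iZ z).
    exact: kermodP.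
  by rewrite -yE [LHS]vE /=; congr (l _); apply: val_inj.
have [x px|k kE] := @factor_surj _ _ _ _ p (linear_add b (\- (cd G h \o v)))
  p_surj.
  have dx : cd E (erefl 2 : 1 + 1 = 2) x = 0 by rewrite [LHS]/= -[LHS]gp px
    linear0.
  have xZ : x \in ker_pred (cd E (erefl 2 : 1 + 1 = 2)) by apply/eqP.
  have := lE (Kermod xZ); rewrite -vZ /= => ->; exact: subrr.
exists k => y; have [x <-] := p_surj y.
rewrite [LHS]/= kE [LHS]linearD [X in _ + X]linearN [X in _ - X](aug_d cone_aug)
  subr0.
exact: bE.
Qed.

Lemma cone_proper0 i (h : i + 1 = 0) :
  gp_relative_epi (corestr (fun x => aug_d cone_aug h x)).
Proof.
move=> X f gpX; have [_ _ aug_ker _] := cone_resolution_subproof.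
have [||x|g gE] := @cone_trunc_lift X i 0 h ((val : {linear kermod _ ->
  _}) \o f) => //.
  by apply: aug_ker; apply: kermodP.
by exists g => x; apply: val_inj; rewrite /= gE.
Qed.

Lemma cone_proper i j k (h : i + 1 = j) (h' : j + 1 = k) : k <= 0 ->
  gp_relative_epi (corestr (fun x => @cdd A G i j k h h' x)).
Proof.
move=> k0 X f gpX; have [_ _ _ exG] := cone_resolution_subproof.
have j0 : j < 0 by apply: lt_le_trans k0; rewrite -h' ltrDl.
have [||x|g gE] := @cone_trunc_lift X i j h ((val : {linear kermod _ ->
  _}) \o f) => //.
- exact: ltW.
- by apply: (exG _ j0 _ _ h h'); apply: kermodP.
by exists g => x; apply: val_inj; rewrite /= gE.
Qed.

Definition cone_resolution : gp_resolution M :=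
  @GPResolution A M G cone_aug cone_resolution_subproof cone_gp cone_proper_aug
    cone_proper0 cone_proper.

End ConeResolution.

(** The comparison argument with relative epimorphisms in place of surjections: each map to be
    lifted goes from a Gorenstein projective term of [G'] into cycles of [G]. In positive degrees
    [G'] vanishes and the zero homotopy serves. *)
Lemma gp_lift_unique (A : pzRingType) (M M' : lmodType A) (f : {linear M' -> M})
    (G : gp_resolution M) (G' : gp_resolution M') (phi psi : chmap G' G) :
  lifts (gpr_aug G') (gpr_aug G) f phi -> lifts (gpr_aug G') (gpr_aug G) f psi
    ->
  homotopic phi psi.
Proof.
move=> phiE psiE; have [G'0 _ _ _] := gpr_resolution G'.
(* Homotopy components are indexed by their target degree; the seed is thus a map out of G'^0 in
   degree -1 and the zero map in degree 0. *)
pose T i := {linear G' (i + 1) -> G i}.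
pose del i : {linear G' i -> G i} := linear_add (phi i) (\- psi i).
have deld i j (h : i + 1 = j) x : del j (cd G' h x) = cd G h (del i x).
  by rewrite /= !chmapd linearD linearN.
pose Q m k (h : m + 1 = k) (a : T m) (b : T k) := forall x : G' k,
  del k x = cd G h (a (cast_degree G' (esym h) x)) + b (cd G' (erefl (k + 1))
    x).
have h0 : Negz 0 + 1 = 0 by [].
have aug0 x : gpr_aug G (del 0 x) = 0 by rewrite linearD linearN phiE psiE
  subrr.
have delE i x : phi i x - psi i x = del i x by [].
clearbody del; have [a0 a0E] := gpr_proper0 h0 (corestr aug0) (gpr_gp G'
  (lexx 0)).
have [|m k l h h' m0 a b _|m k l h h' kl0 b c bc|g gQ _] :=
  @int_choice T Q _ _ h0 a0 \0.
- move=> x; rewrite [X in _ + X]/= addr0 (eq_irrelevance (esym h0) (erefl 0)).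
  exact: esym (congr1 (fun z => kerval z) (a0E x)).
- exists \0 => x; have -> : x = 0.
    by apply: G'0; rewrite -h' -h -ltrBlDr sub0r ltzD1.
  by rewrite !linear0 addr0.
- subst k l; have v0 x : cd G erefl (linear_add (del (m + 1)) (\- (b \o cd G'
    erefl)) x) = 0.
    have := bc (cd G' erefl x); rewrite deld cdd linear0 addr0 /= => dv.
    by rewrite linearD linearN /= dv subrr.
  have m0 : m + 1 + 1 <= 0 by rewrite -ltzD1 ltrD2r (le_lt_trans kl0).
  have [a aE] := gpr_proper (erefl (m + 1)) m0 (corestr v0) (gpr_gp G'
    (ltW (le_lt_trans kl0 (isT : Negz 0 < 0)))).
  exists a => x; have /= -> := congr1 (fun z => kerval z) (aE x).
  by rewrite subrK.
exists (fun i j h => g i \o cast_degree G' (esym h)) => i j k h h' x.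
by subst k; rewrite delE; apply: (gQ _ _ h x).
Qed.

(** * Maps into and between truncated cones *)

Section TruncationMap.
Variables (A : pzRingType) (X Y : complex A) (f : chmap Y X).

Definition trunc_incl : chmap (truncc Y) Y :=
  @ChMap A (truncc Y) Y (fun i => (val : {linear kermod _ -> _}))
    (fun i j h x => erefl).

Fact trunc_map_cycle i : 0 <= i -> forall j (h : i + 1 = j) x,
  cd X h (chmap_comp f trunc_incl i x) = 0.
Proof. by move=> i0 j h x; rewrite /= -chmapd trunc_cycle // linear0. Qed.

Fact trunc_map_gt0 i : 0 < i -> forall x, chmap_comp f trunc_incl i x = 0.
Proof. by move=> i0 x; rewrite (truncc_gt0 x i0) !linear0. Qed.

Definition trunc_map : chmap (truncc Y) (truncc X) :=
  trunc_lift trunc_map_cycle trunc_map_gt0.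

Lemma trunc_mapE i x : kerval (trunc_map i x) = f i (kerval x).
Proof. by []. Qed.

End TruncationMap.

Section ConeIncl.
Variables (A : pzRingType) (T P : complex A) (eps : chmap T P).
Hypothesis P_gt0 : forall i : int, 0 < i -> forall x : P i, x = 0.

Fact cone_incl_d i j (h : i + 1 = j) (x : P i) :
  inl_lin (P j) (T (j + 1)) (cd P h x) = cd (cone eps) h (inl_lin _ _ x).
Proof.
by subst j; rewrite [RHS]cone_dE; congr (_, _); rewrite /= !linear0 ?addr0.
Qed.

Definition cone_incl : chmap P (cone eps) :=
  @ChMap A P (cone eps) (fun i => inl_lin (P i) (T (i + 1))) cone_incl_d.

Fact cone_incl_cycle i : 0 <= i -> forall j (h : i + 1 = j) x,
  cd (cone eps) h (cone_incl i x) = 0.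
Proof.
move=> i0 j h x; rewrite -chmapd [cd P h x]P_gt0 ?linear0 //.
by rewrite -h ltzD1.
Qed.

Fact cone_incl_gt0 i : 0 < i -> forall x, cone_incl i x = 0.
Proof. by move=> i0 x; rewrite [x]P_gt0 // linear0. Qed.

Definition cone_trunc_incl : chmap P (truncc (cone eps)) :=
  trunc_lift cone_incl_cycle cone_incl_gt0.

End ConeIncl.

Section ConeMap.
Variables (A : pzRingType) (T P T' P' : complex A).
Variables (eps : chmap T P) (eps' : chmap T' P').
Variables (tf : chmap T' T) (pf : chmap P' P).

(** The map is (p, t) -> (pf p - s t, tf t) for a homotopy [s] of the square. On the elements (p, d
    t) that make up G^0, [s] enters only through the boundary of [q], which an augmentation
    kills. *)
Lemma cone_map_exists :
  homotopic (chmap_comp eps tf) (chmap_comp pf eps') ->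
  exists F : chmap (cone eps') (cone eps),
    [/\ forall i p, F i (p, 0) = (pf i p, 0), forall i x,
      (F i x).2 = tf (i + 1) x.2
      & forall p t, exists q : P (Negz 0), F 0 (p, cd T' (erefl (0 + 1)) t) =
          (pf 0 p + pf 0 (eps' 0 t) - eps 0 (tf 0 t) + cd P (erefl (Negz 0 + 1))
            q,
            cd T (erefl (0 + 1)) (tf 0 t))].
Proof.
case=> s sE.
pose F i : {linear cone eps' i -> cone eps i} :=
  pair_lin (linear_add (pf i \o fst) (\- (s i (i + 1) erefl \o snd)))
    (tf (i + 1) \o snd).
have Fd i j (h : i + 1 = j) x : F j (cd (cone eps') h x) = cd (cone eps) h (F i
  x).
  subst j; case: x => p t; rewrite [cd _ _ _]cone_dE [RHS]cone_dE.
  rewrite /F /= /lin_fun /=; congr (_, _); last by rewrite linearN chmapd.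
  have /= := sE i (i + 1) (i + 1 + 1) erefl erefl t.
  move/eqP; rewrite subr_eq => /eqP ->.
  rewrite !linearD !linearN !chmapd opprK -[X in _ = _ + X]addrA subrKA.
  by rewrite -addrA [X in _ + X = _]addrC.
exists (ChMap Fd); split=> [i p|i x|p t] //.
  by rewrite /= /lin_fun /= !linear0 addr0.
exists (s _ _ (erefl : Negz 0 + 1 = 0) t).
rewrite /= /lin_fun /=; congr (_, _); last by rewrite chmapd.
have /= := sE (Negz 0) 0 (0 + 1) erefl erefl t.
move/eqP; rewrite subr_eq => /eqP ->.
rewrite -[X in _ = _ - X + _]addrA opprD [X in _ = X + _]addrA.
by rewrite [RHS]addrAC subrK [X in _ = _ - X]addrC addrKA.
Qed.

End ConeMap.

(** * Cohomology of Hom complexes *)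

Section MkAdditive.
Variables (U V : zmodType) (f : U -> V).
Hypothesis f_additive : zmod_morphism f.

Definition additive_fun : U -> V := f.
HB.instance Definition _ := GRing.isZmodMorphism.Build U V additive_fun
  f_additive.
Definition mk_additive : {additive U -> V} := additive_fun.

End MkAdditive.

Lemma coclass_eq (C : zcomplex) (i k : int) (h : k + 1 = i)
  (z z' : cocycle C i) :
  coclass z = coclass z' <-> exists y : C k, zd h y = val z - val z'.
Proof.
have ek : k = i - 1 by rewrite -h addrK.
move: h; subst k => h; rewrite (eq_irrelevance h (subrK 1 i)).
split=> [/eqP|zz']; first by rewrite -Quotient.idealrBE => /asboolP;
  rewrite raddfB.
by apply/eqP; rewrite -Quotient.idealrBE; apply/asboolP; rewrite raddfB.
Qed.

Lemma coclass_surj (C : zcomplex) (i : int) (c : cohomology C i) :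
  exists z, coclass z = c.
Proof. by exists (repr c); apply: reprK. Qed.

Section CohomologyLift.
Variables (C D : zcomplex) (i j : int) (F : {additive C i -> D j}).
Hypothesis F_cycle : forall z : cocycle C i, F (val z) \in @cocycle_pred D j.
Hypothesis F_boundary : forall k (h : k + 1 = i) (y : C k),
  exists l (h' : l + 1 = j) (y' : D l), zd h' y' = F (zd h y).

(** [coh_map] serves degree-preserving chain maps; the connecting map raises degrees and respects
    differentials only up to sign, so cocycles and coboundaries are treated directly. *)
Lemma coh_lift_exists : exists f : {additive cohomology C i -> cohomology D j},
  forall z, f (coclass z) = coclass (Cocycle (F_cycle z)).
Proof.
pose f (c : cohomology C i) := coclass (Cocycle (F_cycle (repr c))).
have fE z : f (coclass z) = coclass (Cocycle (F_cycle z)).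
  have /(coclass_eq (subrK 1 i))[y dy] : coclass (repr (coclass z)) = coclass z.
    exact: reprK.
  have [l [h' [y' y'E]]] := F_boundary (subrK 1 i) y.
  by apply/(coclass_eq h'); exists y'; rewrite y'E dy raddfB.
have f_add : zmod_morphism f.
  move=> x y; have [u <-] := coclass_surj x; have [v <-] := coclass_surj y.
  have <- : coclass (u - v) = coclass u - coclass v by apply: raddfB.
  rewrite !fE -[RHS](raddfB (\pi_({ideal_quot _}))%qT).
  by congr coclass; apply: val_inj; rewrite /= raddfB.
by exists (mk_additive f_add).
Qed.

End CohomologyLift.

Section HomClass.
Variables (A : pzRingType) (X : complex A) (N : lmodType A) (i : int).
Implicit Type u : {linear X (- i) -> N}.

(** Quantifying over [m] avoids naming the predecessor of [- i], which [homc] presents as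
    [- (i + 1)]. *)
Definition hom_cycle u : Prop :=
  forall m (h : m + 1 = - i) x, u (cd X h x) = 0.

Fact hom_cycle_subproof u : hom_cycle u -> u \in @cocycle_pred (homc X N) i.
Proof. by move=> u0; apply/eqP; apply: linear_ext => x; apply: u0. Qed.

Lemma cocycle_hom_cycle u : u \in @cocycle_pred (homc X N) i -> hom_cycle u.
Proof.
move=> uK m; rewrite -[m]opprK; move: (- m) => k h x.
have hk : i + 1 = k by rewrite -[i]opprK -h opprD opprK addrNK.
subst k; have /eqP/(congr1 (fun w : {linear _ -> _} => w x)) := uK.
by rewrite /= (eq_irrelevance (homc_degree _) h).
Qed.

Definition hom_class u (u0 : hom_cycle u) : Hhom X N i :=
  coclass (Cocycle (hom_cycle_subproof u0)).

Lemma hom_class_ind (Phi : Hhom X N i -> Prop) :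
  (forall u (u0 : hom_cycle u), Phi (hom_class u0)) -> forall c, Phi c.
Proof.
move=> PhiE c; have [[u uK] <-] := coclass_surj c.
have u0 := cocycle_hom_cycle uK; rewrite (bool_irrelevance uK
  (hom_cycle_subproof u0)); exact: PhiE.
Qed.

Lemma hom_class_eq l (h : - i + 1 = l) u u' (u0 : hom_cycle u)
  (u0' : hom_cycle u') :
  hom_class u0 = hom_class u0' <->
  exists v : {linear X l -> N}, forall x, v (cd X h x) = u x - u' x.
Proof.
move: h; rewrite -[l]opprK; move: (- l) => k h.
have hk : k + 1 = i by rewrite -[k]opprK -h opprD opprK addrNK.
rewrite (coclass_eq hk); split=> -[v vE]; exists v.
  move=> x; move/(congr1 (fun w : {linear _ -> _} => w x)): vE => /= <-.
  by rewrite /homc_d_fun /= (eq_irrelevance (homc_degree hk) h).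
apply: linear_ext => x /=; rewrite -vE.
by rewrite (eq_irrelevance (homc_degree hk) h).
Qed.

Lemma hom_class_eq0 l (h : - i + 1 = l) u (u0 : hom_cycle u) :
  hom_class u0 = 0 <->
  exists v : {linear X l -> N}, forall x, v (cd X h x) = u x.
Proof.
have z0 : hom_cycle \0 by [].
have <- : hom_class z0 = 0.
  rewrite -[RHS](raddf0 (\pi_({ideal_quot _}))%qT); congr coclass.
  exact: val_inj.
rewrite (hom_class_eq h); split=> -[v vE]; exists v => x;
  rewrite vE /= ?subr0 //.
Qed.

End HomClass.

Section HomFunctoriality.
Variable A : pzRingType.
Implicit Types (X Y Z : complex A) (N : lmodType A).

Lemma hom_class_ext X N i (u u' : {linear X (- i) -> N}) (u0 : hom_cycle u)
    (u0' : hom_cycle u') : u =1 u' -> hom_class u0 = hom_class u0'.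
Proof.
move=> uu'; apply/(hom_class_eq (erefl (- i + 1))).
by exists \0 => x; rewrite /= uu' subrr.
Qed.

Lemma hom_cycle_pre X Y (f : chmap X Y) N i (u : {linear Y (- i) -> N}) :
  hom_cycle u -> hom_cycle (u \o f (- i)).
Proof. by move=> u0 m h x; rewrite /= chmapd u0. Qed.

Lemma Hhom_pre_class X Y (f : chmap X Y) N i (u : {linear Y (- i) -> N})
    (u0 : hom_cycle u) (u0' : hom_cycle (u \o f (- i))) :
  Hhom_pre f N i (hom_class u0) = hom_class u0'.
Proof. by rewrite [LHS]coh_map_coclass; congr coclass; apply: val_inj. Qed.

Lemma hom_cycle_post X N N' (g : {linear N -> N'}) i (u : {linear X (- i) ->
  N}) :
  hom_cycle u -> hom_cycle (g \o u).
Proof. by move=> u0 m h x; rewrite /= u0 linear0. Qed.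

Lemma Hhom_post_class X N N' (g : {linear N -> N'}) i (u : {linear X (- i) ->
  N})
    (u0 : hom_cycle u) (u0' : hom_cycle (g \o u)) :
  Hhom_post X g i (hom_class u0) = hom_class u0'.
Proof. by rewrite [LHS]coh_map_coclass; congr coclass; apply: val_inj. Qed.

Lemma Hhom_pre_comp X Y Z (g : chmap Y Z) (f : chmap X Y) N i c :
  Hhom_pre (chmap_comp g f) N i c = Hhom_pre f N i (Hhom_pre g N i c).
Proof.
elim/hom_class_ind: c => u u0.
have gu0 := hom_cycle_pre g u0; have fgu0 := hom_cycle_pre f gu0.
have gfu0 := hom_cycle_pre (chmap_comp g f) u0.
rewrite (Hhom_pre_class u0 gu0) (Hhom_pre_class gu0 fgu0) (Hhom_pre_class u0
  gfu0).
exact: hom_class_ext.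
Qed.

Lemma Hhom_pre_id X N i c : Hhom_pre (chmap_id X) N i c = c.
Proof.
elim/hom_class_ind: c => u u0.
rewrite (Hhom_pre_class u0 (hom_cycle_pre _ u0)); exact: hom_class_ext.
Qed.

Lemma Hhom_pre_homotopic X Y (f g : chmap X Y) N i : homotopic f g ->
  Hhom_pre f N i =1 Hhom_pre g N i.
Proof.
case=> s sE; elim/hom_class_ind=> u u0.
rewrite (Hhom_pre_class u0 (hom_cycle_pre f u0)) (Hhom_pre_class u0
  (hom_cycle_pre g u0)).
apply/(hom_class_eq (erefl (- i + 1))).
exists (u \o s (- i) (- i + 1) erefl) => x /=.
by rewrite -linearB (sE _ _ _ (subrK 1 (- i)) erefl) linearD u0 add0r.
Qed.

Lemma Hhom_pre_post X Y (f : chmap X Y) N N' (g : {linear N -> N'}) i c :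
  Hhom_post X g i (Hhom_pre f N i c) = Hhom_pre f N' i (Hhom_post Y g i c).
Proof.
elim/hom_class_ind: c => u u0.
have fu0 := hom_cycle_pre f u0; have gu0 := hom_cycle_post g u0.
rewrite (Hhom_pre_class u0 fu0) (Hhom_post_class u0 gu0).
rewrite (Hhom_post_class fu0 (hom_cycle_post g fu0)).
rewrite (Hhom_pre_class gu0 (hom_cycle_pre f gu0)).
exact: hom_class_ext.
Qed.

End HomFunctoriality.

(** * The connecting map and the long exact sequence of the truncated cone *)

Section Connecting.
Variables (A : pzRingType) (T P : complex A) (eps : chmap T P).
Let G := truncc (cone eps).

Definition cone_proj (k l : int) (h : k + 1 = l) : {linear G k -> T l} :=
  cast_degree T h \o (snd \o (val : {linear kermod _ ->
    (P k * T (k + 1)%R)%type})).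

Lemma cone_proj_d k l m (h : k + 1 = l) (h' : l + 1 = m) x :
  cone_proj h' (cd G h x) = - cd T h' (cone_proj h x).
Proof.
subst l m; rewrite /cone_proj /=; case: (kerval x) => p t /=.
by rewrite /cone_d /= /lin_fun /= (eq_irrelevance (shift_degree 1 erefl)
  (erefl (k + 1 + 1))).
Qed.

Variable N : lmodType A.

Lemma hom_cycle_proj i j (h : i + 1 = j) (u : {linear T (- i) -> N}) :
  hom_cycle u -> hom_cycle (u \o cone_proj (homc_degree h)).
Proof.
by move=> u0 m h' x; rewrite [LHS](congr1 u (cone_proj_d _ _ x)) linearN u0
  oppr0.
Qed.

Lemma connecting_exists i j (h : i + 1 = j) :
  exists d : {additive Hhom T N i -> Hhom G N j},
    forall u (u0 : hom_cycle u), d (hom_class u0) = hom_class (hom_cycle_proj h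
      u0).
Proof.
pose f (u : homc T N i) : homc G N j := u \o cone_proj (homc_degree h).
have f_add : zmod_morphism f by move=> u v; apply: linear_ext.
have Fc (z : cocycle (homc T N) i) :
    mk_additive f_add (val z) \in @cocycle_pred (homc G N) j.
  case: z => u uK; apply: hom_cycle_subproof; apply: hom_cycle_proj.
  exact: cocycle_hom_cycle.
have [k hk y|d dE] := coh_lift_exists Fc.
  (* The sign is there because [cone_proj] anticommutes with the differentials. *)
  exists i, h, (\- ((y : {linear T (- k) -> N}) \o cone_proj (homc_degree hk)) :
    {linear _ -> _}).
  by apply: linear_ext => x; rewrite [LHS](congr1 (\- y) (cone_proj_d _ _ x)) /=
    linearN opprK.
exists d => u u0; rewrite dE; congr coclass; exact: val_inj.
Qed.

Definition connecting i j (h : i + 1 = j) : {additive Hhom T N i ->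
  Hhom G N j} :=
  sval (cid (connecting_exists h)).

Lemma connectingE i j (h : i + 1 = j) u (u0 : hom_cycle u) :
  connecting h (hom_class u0) = hom_class (hom_cycle_proj h u0).
Proof. exact: (svalP (cid (connecting_exists h))). Qed.

End Connecting.

Arguments cone_proj {A T P eps k l} h.

Lemma hom_cycleI (A : pzRingType) (X : complex A) (N : lmodType A) (i m : int)
    (h : m + 1 = - i) (u : {linear X (- i) -> N}) :
  (forall x, u (cd X h x) = 0) -> hom_cycle u.
Proof.
move=> u0 m' h' x; have em : m' = m by apply: (addIr 1); rewrite h' h.
by subst m'; rewrite (eq_irrelevance h' h).
Qed.

Section ConeExactness.
Variables (A : pzRingType) (T P : complex A) (eps : chmap T P).
Hypothesis P_gt0 : forall i : int, 0 < i -> forall x : P i, x = 0.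
Let G := truncc (cone eps).

Let gP : chmap P G := cone_trunc_incl eps P_gt0.

(** Below degree 0 this is the second inclusion of the splitting P^k + T^(k+1). It is not a chain
    map: by [gT_d] it contracts [gP] after [eps], and the exactness proofs rest on this. *)
Let gT (k l : int) (k0 : k < 0) (h : k + 1 = l) : {linear T l -> G k} :=
  trunc_mk (cone eps) k0 \o (inr_lin (P k) (T (k + 1)) \o cast_degree T
    (esym h)).

Let projP (k : int) : {linear G k -> P k} :=
  fst \o (val : {linear kermod _ -> (P k * T (k + 1)%R)%type}).

Let projP_d k l (h : k + 1 = l) x :
  projP l (cd G h x) = cd P h (projP k x) + eps l (cone_proj h x).
Proof.
by subst l; rewrite /projP /= /cone_d /= /lin_fun /=.
Qed.

Let gT_d k l m (k0 : k < 0) (l0 : l < 0) (h : k + 1 = l) (h' : l + 1 = m) t :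
  cd G h (gT k0 h t) = gP l (eps l t) - gT l0 h' (cd T h' t).
Proof.
subst m l; apply: val_inj; rewrite raddfB.
rewrite [LHS](cone_dE eps) /= /lin_fun /= !linear0 add0r.
by congr (_, _); rewrite /= ?subr0 ?sub0r.
Qed.

Let G_split k l (k0 : k < 0) (h : k + 1 = l) x :
  x = gP k (projP k x) + gT k0 h (cone_proj h x).
Proof.
subst l; apply: val_inj; rewrite raddfD /= /cone_proj /projP /= /lin_fun /=.
by rewrite [LHS]surjective_pairing; congr (_, _); rewrite /= ?addr0 ?add0r.
Qed.

Let proj_gT k l (k0 : k < 0) (h : k + 1 = l) t : cone_proj h (gT k0 h t) = t.
Proof. by subst l. Qed.

Let proj_gP k l (h : k + 1 = l) p : cone_proj h (gP k p) = 0.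
Proof. by subst l. Qed.

Let projP_gP k p : projP k (gP k p) = p.
Proof. by []. Qed.

Variable N : lmodType A.

Let a i : {additive Hhom G N i -> Hhom P N i} := Hhom_pre gP N i.
Let b i : {additive Hhom P N i -> Hhom T N i} := Hhom_pre eps N i.
Let c i j (h : i + 1 = j) : {additive Hhom T N i -> Hhom G N j} :=
  connecting eps N h.

Lemma cone_exact_ab i : 0 < i -> exact_pair (a i) (b i).
Proof.
move=> i0; have i0' : - i < 0 by rewrite oppr_lt0.
have m0 : - i - 1 < 0 by rewrite -opprD oppr_lt0 addr_gt0.
elim/hom_class_ind=> w w0; rewrite (Hhom_pre_class w0 (hom_cycle_pre eps w0)).
split=> [/(hom_class_eq0 (erefl (- i + 1)))[z zE]|[x]].
  (* The equation z d = w eps is exactly what makes [w] on P and [z] on T together a cocycle on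
     G. *)
  pose u : {linear G (- i) -> N} :=
    linear_add (w \o projP (- i)) (z \o cone_proj (erefl (- i + 1))).
  have uE x : u x = w (projP (- i) x) + z (cone_proj erefl x) by [].
  have u0 : hom_cycle u.
    move=> m h x; rewrite uE.
    by rewrite projP_d cone_proj_d linearN linearD zE w0 add0r subrr.
  exists (hom_class u0); rewrite (Hhom_pre_class u0 (hom_cycle_pre gP u0)).
  by apply: hom_class_ext => p; rewrite [LHS]uE projP_gP proj_gP linear0 addr0.
elim/hom_class_ind: x => u u0; rewrite (Hhom_pre_class u0 (hom_cycle_pre gP u0))
  => uw.
have <- := Hhom_pre_class w0 (hom_cycle_pre eps w0).
rewrite -uw; pose ug0 := hom_cycle_pre gP u0.
rewrite (Hhom_pre_class ug0 (hom_cycle_pre eps ug0)).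
apply/(hom_class_eq0 (erefl (- i + 1))).
exists (u \o gT i0' (erefl (- i + 1))) => t /=.
have := u0 _ (subrK 1 (- i)) (gT m0 (subrK 1 (- i)) t).
by rewrite (gT_d m0 i0' (subrK 1 (- i)) (erefl (- i + 1))) linearB =>
  /subr0_eq ->.
Qed.

Lemma cone_exact_bc i j (h : i + 1 = j) : 0 < i -> exact_pair (b i) (c h).
Proof.
move=> i0; have i0' : - i < 0 by rewrite oppr_lt0.
have j0 : - j < 0 by rewrite -h oppr_lt0 addr_gt0.
have hk := homc_degree h.
elim/hom_class_ind=> w w0; rewrite /c connectingE.
split=> [/(hom_class_eq0 hk)[v vE']|[x]].
  have vE x : v (cd G hk x) = w (cone_proj (homc_degree h) x) := vE' x.
  have v0 : hom_cycle (v \o gP (- i)).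
    apply: (hom_cycleI (h := hk)) => p.
    by rewrite [LHS](congr1 v (chmapd gP hk p)) vE proj_gP linear0.
  exists (hom_class v0); rewrite (Hhom_pre_class v0 (hom_cycle_pre eps v0)).
  apply/(hom_class_eq (erefl (- i + 1))).
  exists (v \o gT i0' (erefl (- i + 1))) => t.
  have := vE (gT j0 hk t); rewrite (gT_d j0 i0' hk (erefl (- i + 1))).
  rewrite (eq_irrelevance (homc_degree h) hk) proj_gT linearB => <-.
  exact: esym (subKr _ _).
elim/hom_class_ind: x => u u0; rewrite (Hhom_pre_class u0 (hom_cycle_pre eps
  u0)) => uw.
rewrite -connectingE -uw connectingE; apply/(hom_class_eq0 hk).
exists (u \o projP (- i)) => x; rewrite [LHS](congr1 u (projP_d hk x)) linearD
  u0 add0r.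
by rewrite (eq_irrelevance (homc_degree h) hk).
Qed.

Lemma cone_exact_ca i j (h : i + 1 = j) : 0 < i -> exact_pair (c h) (a j).
Proof.
move=> i0; have i0' : - i < 0 by rewrite oppr_lt0.
have j0 : - j < 0 by rewrite -h oppr_lt0 addr_gt0.
have hk := homc_degree h.
have m0 : - j - 1 < 0 by rewrite -opprD oppr_lt0 addr_gt0 // -oppr_lt0.
elim/hom_class_ind=> u u0; rewrite (Hhom_pre_class u0 (hom_cycle_pre gP u0)).
split=> [/(hom_class_eq0 hk)[v vE]|[x]].
  (* [u] restricted to T need not be a cocycle; subtracting [v \o eps] repairs this because [v]
     bounds the restriction of [u] to P. The image of [w] then differs from [u] by the boundary of
     [v \o projP], up to sign. *)
  pose w : {linear T (- i) -> N} := linear_add (u \o gT j0 hk) (\- (v \o eps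
    (- i))).
  have wE t : w t = u (gT j0 hk t) - v (eps (- i) t) by [].
  have w0 : hom_cycle w.
    apply: (hom_cycleI (h := hk)) => t; rewrite wE.
    have := u0 _ (subrK 1 (- j)) (gT m0 (subrK 1 (- j)) t).
    rewrite (gT_d m0 j0 (subrK 1 (- j)) hk) linearB => /subr0_eq <-.
    by rewrite chmapd vE subrr.
  exists (hom_class w0); rewrite /c connectingE; apply/(hom_class_eq hk).
  exists (\- (v \o projP (- i))) => x.
  have uE : u x = v (cd P hk (projP (- j) x)) + u (gT j0 hk (cone_proj hk x)).
    by rewrite vE {1}(G_split j0 hk x) linearD.
  rewrite [LHS](congr1 (fun y => - v y) (projP_d hk x)) linearD uE.
  rewrite [X in _ = X - _](_ : _ = w (cone_proj hk x)); last first.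
    by rewrite (eq_irrelevance (homc_degree h) hk).
  rewrite wE.
  rewrite [X in _ = _ - X]addrC !opprD [RHS]addrA [X in _ = X - _]addrAC subrr.
  by rewrite add0r addrC.
elim/hom_class_ind: x => w w0; rewrite /c connectingE => wu.
rewrite -(Hhom_pre_class u0 (hom_cycle_pre gP u0)) -wu.
rewrite (Hhom_pre_class _ (hom_cycle_pre gP (hom_cycle_proj h w0))).
apply/(hom_class_eq0 hk); exists \0 => p.
by rewrite [RHS](congr1 w (proj_gP _ p)) linear0.
Qed.

Lemma cone_inj_a : (forall i, exact_at T i) -> injective (a 1).
Proof.
move=> exT; apply: raddf_inj; elim/hom_class_ind=> u u0.
rewrite (Hhom_pre_class u0 (hom_cycle_pre gP u0)).
have h : - 1 + 1 = 0 :> int by [].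
have i0 : - 1 < 0 :> int by [].
have m0 : - 1 - 1 < 0 :> int by [].
move/(hom_class_eq0 h) => [v vE']; apply/(hom_class_eq0 h).
have vE p : v (cd P h p) = u (gP (- 1) p) := vE' p.
(* On T^0 this is minus the cocycle [w] of [cone_exact_ca], one degree lower; it vanishes on B^0(T)
   = Z^0(T), so [f] descends to G^0. *)
pose f : {linear (P 0 * T 0)%type -> N} :=
  linear_add (v \o linear_add fst (eps 0 \o snd)) (\- (u \o (gT i0 h \o snd))).
have fE p t : f (p, t) = v (p + eps 0 t) - u (gT i0 h t) by [].
have [[p t] z0|w wE] := factor_surj (f := f) (cone_start_surj (eps :=
  eps) P_gt0 exT).
  have [p0 dt] := congr1 (fun z => kerval z) z0.
  have [t' t'E] := exT _ _ _ h (erefl (0 + 1)) t dt.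
  rewrite fE [p]p0 add0r -t'E [eps _ _]chmapd vE.
  have := u0 _ (subrK 1 (- 1)) (gT m0 (subrK 1 (- 1)) t').
  by rewrite (gT_d m0 i0 (subrK 1 (- 1)) h) linearB.
exists w => x; rewrite cone_start_d wE fE [eps 0 (- _)]linearN addrK vE.
rewrite [gT _ _ (- _)]linearN [u (- _)]linearN opprK -linearD; congr (u _).
exact: esym (G_split i0 h x).
Qed.

End ConeExactness.

(** * Comparison with an arbitrary resolution *)

Section Counit.
Variables (C D : category) (L : functor C D) (R : functor D C).
Variable LR : adjunction L R.

Definition counit (Y : D) : Defs.hom (L (R Y)) Y := adjV LR (idm (R Y)).

Lemma adj_counit X Y (f : Defs.hom X (R Y)) :
  adj LR (cmp (counit Y) (fmap L f)) =h f.
Proof.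
apply: heq_trans (adj_natl LR _ _) _.
apply: heq_trans (cmp_heq (adjVK LR _) (heq_refl _)) _.
exact: cmp_idl.
Qed.

Lemma counit_onto X Y (g : Defs.hom (L X) Y) :
  cmp (counit Y) (fmap L (adj LR g)) =h g.
Proof.
apply: heq_trans (heq_sym (adjK LR _)) _.
by apply: heq_trans (adjV_heq LR (adj_counit _)) _; apply: adjK.
Qed.

Lemma counit_inj X Y (f f' : Defs.hom X (R Y)) :
  cmp (counit Y) (fmap L f) =h cmp (counit Y) (fmap L f') -> f =h f'.
Proof.
move=> /(adj_heq LR) ff'; apply: heq_trans (heq_sym (adj_counit f)) _.
exact: heq_trans ff' (adj_counit f').
Qed.

(** In K(Pro A) the relation [=h] is homotopy, so this supplies the hypothesis of
    [cone_map_exists]. *)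
Lemma counit_nat Y Y' (b : Defs.hom Y Y') :
  cmp (counit Y') (fmap L (fmap R b)) =h cmp b (counit Y).
Proof.
apply: heq_trans (heq_sym (adjK LR _)) _.
apply: heq_trans (adjK LR _); apply: adjV_heq.
apply: heq_trans (adj_counit _) _; apply: heq_sym.
apply: heq_trans (adj_natr LR _ _) _.
apply: heq_trans (cmp_heq (heq_refl _) (adjVK LR _)) _.
exact: cmp_idr.
Qed.

End Counit.

Lemma Hhom_pre_eq (A : pzRingType) (X Y : complex A) (f g : chmap X Y)
    (N : lmodType A) i : (forall j x, f j x = g j x) ->
  Hhom_pre f N i =1 Hhom_pre g N i.
Proof.
move=> fg; apply: Hhom_pre_homotopic; exists (fun _ _ _ => \0) => j k l h h' x.
by rewrite fg subrr linear0 addr0.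
Qed.

Section GorensteinComparison.
Variable A : pzRingType.

Lemma Hhom_pre_lifts (M M' : lmodType A) (f : {linear M' -> M})
    (G : gp_resolution M) (G' : gp_resolution M') (phi psi : chmap G' G) N i :
  lifts (gpr_aug G') (gpr_aug G) f phi -> lifts (gpr_aug G') (gpr_aug G) f psi
    ->
  Hhom_pre phi N i =1 Hhom_pre psi N i.
Proof. by move=> phiE psiE; apply: Hhom_pre_homotopic;
  apply: gp_lift_unique phiE psiE. Qed.

Variables (M : lmodType A) (G G' : gp_resolution M).

Definition gp_compare : chmap G' G := sval (cid (gp_lift_exists idfun G G')).

Lemma gp_compareP x : gpr_aug G (gp_compare 0 x) = gpr_aug G' x.
Proof. exact: (svalP (cid (gp_lift_exists idfun G G'))). Qed.

End GorensteinComparison.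

Lemma gp_compareK (A : pzRingType) (M : lmodType A)
  (G G' : gp_resolution M) N i :
  cancel (Hhom_pre (gp_compare G G') N i) (Hhom_pre (gp_compare G' G) N i).
Proof.
move=> c; rewrite -Hhom_pre_comp -[RHS](@Hhom_pre_id _ G N i c).
by apply: (Hhom_pre_lifts (f := idfun)) => x; rewrite /= ?gp_compareP.
Qed.

(** Both sides are induced by chain maps lifting [f], hence agree for any lifts [phi] and [psi];
    this carries naturality from the cone resolution to all others. *)
Lemma gp_compare_natural (A : pzRingType) (M M' : lmodType A)
    (f : {linear M' -> M}) (G H : gp_resolution M) (G' H' : gp_resolution M')
    (phi : chmap G' G) (psi : chmap H' H) N i c :
  lifts (gpr_aug G') (gpr_aug G) f phi -> lifts (gpr_aug H') (gpr_aug H) f psi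
    ->
  Hhom_pre psi N i (Hhom_pre (gp_compare G H) N i c) =
  Hhom_pre (gp_compare G' H') N i (Hhom_pre phi N i c).
Proof.
move=> phiE psiE; rewrite -!Hhom_pre_comp.
apply: (Hhom_pre_lifts (f := f)) => x /=; first by rewrite gp_compareP psiE.
by rewrite phiE gp_compareP.
Qed.

(** * The exact sequence for the counit and its naturality *)

Section TateSequence.
Variables (A : pzRingType) (e : functor (KPro A) (E_cat A)).
Variables (e_adj : adjunction (E_incl A) e) (R : resolution_functor A).
Implicit Types M N : lmodType A.

Definition proj_res M : complex A := sval (res R M).
Definition tate_res M : complex A := sval (sval (e (res R M))).
Definition tate_counit M : chmap (tate_res M) (proj_res M) :=
  counit e_adj (res R M).

Lemma proj_res_projective M i : projective (proj_res M i).
Proof. exact: svalP (res R M) i. Qed.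

Lemma proj_res_gt0 M i : 0 < i -> forall x : proj_res M i, x = 0.
Proof. by case: (res_resolution R M) => + _ _ _ i0 x; apply. Qed.

Lemma tate_res_acyclic M : totally_acyclic (tate_res M).
Proof. exact: svalP (e (res R M)). Qed.

Lemma tate_counit_onto M (E : complex A) (g : chmap E (proj_res M)) :
  totally_acyclic E ->
  exists f : chmap E (tate_res M), homotopic g (chmap_comp (tate_counit M) f).
Proof.
move=> acE; have [pE _ _] := acE.
pose E' : E_cat A := exist _ (exist _ E pE : KPro A) acE.
exists (adj e_adj (X := E') (Y := res R M) g); apply: homotopic_sym.
exact: (@counit_onto _ _ _ _ e_adj E' (res R M) g).
Qed.

Lemma tate_counit_inj M (E : complex A) (f f' : chmap E (tate_res M)) :
  totally_acyclic E ->
  homotopic (chmap_comp (tate_counit M) f) (chmap_comp (tate_counit M) f') ->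
    homotopic f f'.
Proof.
move=> acE; have [pE _ _] := acE.
pose E' : E_cat A := exist _ (exist _ E pE : KPro A) acE.
exact: (@counit_inj _ _ _ _ e_adj E' (res R M) f f').
Qed.

Definition cone_gp_resolution M : gp_resolution M :=
  cone_resolution (@proj_res_projective M) (tate_res_acyclic M)
    (@tate_counit_onto M) (@tate_counit_inj M)
    (res_resolution R M).

Definition proj_res_incl M : chmap (proj_res M) (cone_gp_resolution M) :=
  cone_trunc_incl (tate_counit M) (@proj_res_gt0 M).

(** Although the counit square commutes only up to homotopy, the map of cones commutes strictly with
    the inclusion of P and the projection to T, as naturality of the outer maps requires. *)
Lemma cone_gp_resolution_map M M' (f : {linear M' -> M}) :
  exists F : chmap (cone_gp_resolution M') (cone_gp_resolution M),
    [/\ lifts (gpr_aug (cone_gp_resolution M'))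
          (gpr_aug (cone_gp_resolution M)) f F,
        forall i p, F i (proj_res_incl M' i p) =
          proj_res_incl M i (fmap R (f : @Defs.hom (Mod A) M' M) i p)
      & forall k l (h : k + 1 = l) x, cone_proj h (F k x) =
          fmap e (fmap R (f : @Defs.hom (Mod A) M' M)) l (cone_proj h x)].
Proof.
pose pf : chmap (proj_res M') (proj_res M) :=
  fmap R (f : @Defs.hom (Mod A) M' M).
pose tf : chmap (tate_res M') (tate_res M) :=
  fmap e (fmap R (f : @Defs.hom (Mod A) M' M)).
have [|F [F1 F2 F3]] :=
  @cone_map_exists _ _ _ _ _ (tate_counit M) (tate_counit M') tf pf.
  exact: (counit_nat e_adj (fmap R (f : @Defs.hom (Mod A) M' M))).
exists (trunc_map F); split=> [x|i p|k l h x].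
- have [_ exT _] := tate_res_acyclic M'.
  have [[p t] <-] := cone_start_surj (eps := tate_counit M') (@proj_res_gt0 M')
    exT x.
  set y := cone_start _ _ _.
  have yE : kerval y = (p, cd (tate_res M') (erefl (0 + 1)) t) by [].
  have [q] := F3 p t; rewrite -yE -trunc_mapE => qE.
  rewrite [LHS](cone_augE (tate_res_acyclic M) (res_resolution R M) qE).
  rewrite [X in _ = f X](cone_augE (tate_res_acyclic M') (res_resolution R M')
    yE).
  (* The two terms in the counit of [M] cancel, and the augmentation kills the boundary of [q]. *)
  rewrite addrAC subrK linearD [X in _ + X]aug_d addr0 -linearD.
  exact: res_lifts.
- by apply: val_inj; apply: F1.
- by subst l; apply: F2.
Qed.

Definition tate_a M (G : gp_resolution M) N i :
    {additive ExtG G N i -> Ext R M N i} :=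
  Hhom_pre (proj_res_incl M) N i \o
  Hhom_pre (gp_compare G (cone_gp_resolution M)) N i.
Definition tate_b M N i : {additive Ext R M N i -> TateExt e R M N i} :=
  Hhom_pre (tate_counit M) N i.
Definition tate_c M (G : gp_resolution M) N i j (h : i + 1 = j) :
    {additive TateExt e R M N i -> ExtG G N j} :=
  Hhom_pre (gp_compare (cone_gp_resolution M) G) N j \o
  connecting (tate_counit M) N h.

Lemma tate_inj_a M (G : gp_resolution M) N : injective (tate_a G N 1).
Proof.
have [_ exT _] := tate_res_acyclic M.
apply: inj_comp (can_inj (@gp_compareK _ _ _ _ _ _)).
exact: cone_inj_a.
Qed.

Lemma tate_exact_ab M (G : gp_resolution M) N i : 0 < i ->
  exact_pair (tate_a G N i) (tate_b M N i).
Proof.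
move=> i0 y; rewrite (cone_exact_ab (tate_counit M) (@proj_res_gt0 M) i0);
  split=> -[x <-].
  exists (Hhom_pre (gp_compare (cone_gp_resolution M) G) N i x).
  exact: (congr1 (Hhom_pre (proj_res_incl M) N i) (@gp_compareK _ _
    (cone_gp_resolution M) G N i x)).
by exists (Hhom_pre (gp_compare G (cone_gp_resolution M)) N i x).
Qed.

Lemma tate_exact_bc M (G : gp_resolution M) N i j (h : i + 1 = j) : 0 < i ->
  exact_pair (tate_b M N i) (tate_c G N h).
Proof.
move=> i0 y; rewrite -(cone_exact_bc (tate_counit M) (@proj_res_gt0 M) h i0).
split=> [cy|cy]; last exact: (etrans (congr1 (Hhom_pre _ N j) cy) (raddf0 _)).
apply: (can_inj (@gp_compareK _ _ (cone_gp_resolution M) G N j));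
  exact: (etrans cy (esym (raddf0 _))).
Qed.

Lemma tate_exact_ca M (G : gp_resolution M) N i j (h : i + 1 = j) : 0 < i ->
  exact_pair (tate_c G N h) (tate_a G N j).
Proof.
move=> i0 y.
have E := cone_exact_ca (eps := tate_counit M) (@proj_res_gt0 M) h i0
  (Hhom_pre (gp_compare G (cone_gp_resolution M)) N j y).
apply: (iff_trans E); split=> -[x xE]; exists x.
  exact: (etrans (congr1 (Hhom_pre (gp_compare (cone_gp_resolution M) G) N j)
    xE) (@gp_compareK _ _ G (cone_gp_resolution M) N j y)).
by rewrite -xE; apply: esym (@gp_compareK _ _ (cone_gp_resolution M) G N j _).
Qed.

Section NaturalLeft.
Variables (M M' : lmodType A) (f : {linear M' -> M}).
Variables (G : gp_resolution M) (G' : gp_resolution M') (phi : chmap G' G).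
Hypothesis phiE : lifts (gpr_aug G') (gpr_aug G) f phi.
Variable N : lmodType A.

Lemma tate_a_natl i : Ext_pre R f N i \o tate_a G N i =1 tate_a G' N i \o
  ExtG_pre phi N i.
Proof.
move=> y.
have [F [FE Fi _]] := cone_gp_resolution_map f.
pose pf : chmap (proj_res M') (proj_res M) :=
  fmap R (f : @Defs.hom (Mod A) M' M).
have E1 z : Hhom_pre pf N i (Hhom_pre (proj_res_incl M) N i z) =
    Hhom_pre (proj_res_incl M') N i (Hhom_pre F N i z).
  apply: etrans (esym (Hhom_pre_comp (proj_res_incl M) pf z)) _.
  apply: etrans _ (Hhom_pre_comp F (proj_res_incl M') z).
  by apply: Hhom_pre_eq => j x; apply: esym (Fi j x).
have E2 := gp_compare_natural (N := N) (i := i) y phiE FE.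
exact: etrans (E1 _) (congr1 _ E2).
Qed.

Lemma tate_b_natl i :
  TateExt_pre e R f N i \o tate_b M N i =1 tate_b M' N i \o Ext_pre R f N i.
Proof.
move=> y; rewrite /tate_b /= -[LHS]Hhom_pre_comp -[RHS]Hhom_pre_comp.
apply: Hhom_pre_homotopic.
exact: (counit_nat e_adj (fmap R (f : @Defs.hom (Mod A) M' M))).
Qed.

Lemma tate_c_natl i j (h : i + 1 = j) :
  ExtG_pre phi N j \o tate_c G N h =1 tate_c G' N h \o TateExt_pre e R f N i.
Proof.
move=> y.
have [F [FE _ Fq]] := cone_gp_resolution_map f.
pose tf : chmap (tate_res M') (tate_res M) :=
  fmap e (fmap R (f : @Defs.hom (Mod A) M' M)).
have E1 : Hhom_pre F N j (connecting (tate_counit M) N h y) =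
    connecting (tate_counit M') N h (Hhom_pre tf N i y).
  elim/hom_class_ind: y => u u0.
  have tu0 := hom_cycle_pre tf u0.
  rewrite (Hhom_pre_class u0 tu0) !connectingE.
  have qu0 := hom_cycle_proj (eps := tate_counit M) h u0.
  rewrite (Hhom_pre_class _ (hom_cycle_pre F qu0)).
  by apply: hom_class_ext => x; apply: (congr1 u (Fq _ _ (homc_degree h) x)).
have E2 z := gp_compare_natural (N := N) (i := j) z FE phiE.
exact: etrans (E2 _) (congr1 _ E1).
Qed.

End NaturalLeft.

Section NaturalRight.
Variables (M : lmodType A) (G : gp_resolution M).
Variables (N N' : lmodType A) (g : {linear N -> N'}).

Lemma tate_a_natr i : Ext_post R M g i \o tate_a G N i =1 tate_a G N' i \o
  ExtG_post G g i.
Proof.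
move=> y; apply: etrans (Hhom_pre_post (proj_res_incl M) g _) _.
exact (congr1 (Hhom_pre (proj_res_incl M) N' i) (Hhom_pre_post (gp_compare G
  (cone_gp_resolution M)) g y)).
Qed.

Lemma tate_b_natr i :
  TateExt_post e R M g i \o tate_b M N i =1 tate_b M N' i \o Ext_post R M g i.
Proof. by move=> y; apply: Hhom_pre_post. Qed.

Lemma tate_c_natr i j (h : i + 1 = j) :
  ExtG_post G g j \o tate_c G N h =1 tate_c G N' h \o TateExt_post e R M g i.
Proof.
move=> y; apply: etrans (Hhom_pre_post (gp_compare (cone_gp_resolution M) G) g
  _) _.
apply: (congr1 (Hhom_pre (gp_compare (cone_gp_resolution M) G) N' j)).
elim/hom_class_ind: y => u u0; have gu0 := hom_cycle_post g u0.
rewrite (Hhom_post_class u0 gu0) !connectingE.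
have qu0 := hom_cycle_proj (eps := tate_counit M) h u0.
by rewrite (Hhom_post_class _ (hom_cycle_post g qu0)); apply: hom_class_ext.
Qed.

End NaturalRight.

End TateSequence.

Theorem theorem5p3 (A : pzRingType) (e : functor (KPro A) (E_cat A))
    (e_adj : adjunction (E_incl A) e) (R : resolution_functor A) :
  exists
    (a : forall (M : lmodType A) (G : gp_resolution M) (N : lmodType A) (n : nat),
      {additive ExtG G N n.+1%:Z -> Ext R M N n.+1%:Z})
    (b : forall (M N : lmodType A) (n : nat),
      {additive Ext R M N n.+1%:Z -> TateExt e R M N n.+1%:Z})
    (c : forall (M : lmodType A) (G : gp_resolution M) (N : lmodType A) (n : nat),
      {additive TateExt e R M N n.+1%:Z -> ExtG G N n.+2%:Z}),
  [/\ (* exactness *)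
      forall (M : lmodType A) (G : gp_resolution M) (N : lmodType A),
        injective (a M G N 0%N) /\
        forall n : nat,
          [/\ exact_pair (a M G N n) (b M N n),
              exact_pair (b M N n) (c M G N n)
            & exact_pair (c M G N n) (a M G N n.+1)],
      (* naturality in M *)
      forall (M M' : lmodType A) (f : {linear M' -> M})
          (G : gp_resolution M) (G' : gp_resolution M') (phi : chmap G' G),
        lifts (gpr_aug G') (gpr_aug G) f phi ->
        forall (N : lmodType A) (n : nat),
          [/\ Ext_pre R f N _ \o a M G N n =1 a M' G' N n \o ExtG_pre phi N _,
              TateExt_pre e R f N _ \o b M N n =1 b M' N n \o Ext_pre R f N _
            & ExtG_pre phi N _ \o c M G N n
                =1 c M' G' N n \o TateExt_pre e R f N _]
    & (* naturality in N *)
      forall (M : lmodType A) (G : gp_resolution M) (N N' : lmodType A)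
          (g : {linear N -> N'}) (n : nat),
        [/\ Ext_post R M g _ \o a M G N n =1 a M G N' n \o ExtG_post G g _,
            TateExt_post e R M g _ \o b M N n =1 b M N' n \o Ext_post R M g _
          & ExtG_post G g _ \o c M G N n =1 c M G N' n \o TateExt_post e R M g _]].
Proof.
have deg (n : nat) : n.+1%:Z + 1 = n.+2%:Z by rewrite -PoszD addn1.
exists (fun M G N n => tate_a e_adj R G N n.+1%:Z),
  (fun M N n => tate_b e_adj R M N n.+1%:Z),
  (fun M G N n => tate_c e_adj R G N (deg n)).
split=> [M G N|M M' f G G' phi phiE N n|M G N N' g n].
- split=> [|n]; first exact: tate_inj_a.
  by split; [apply: tate_exact_ab | apply: tate_exact_bc | apply:
    tate_exact_ca].
- by split; [apply: tate_a_natl | apply: tate_b_natl | apply: tate_c_natl].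
- by split; [apply: tate_a_natr | apply: tate_b_natr | apply: tate_c_natr].
Qed.
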